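(* Let $f(z)\in\mathbb{C}[z]$ be a non-constant monic polynomial of degree $N$, let $A=\{\alpha_1,\dots,\alpha_s\}$ be its set of complex roots, $\mathcal{K}$ the convex hull of $A$, $R$ the radius of a closed disk containing $A$, and $B$ the set of roots of $f'$ that are not roots of $f$. For $\beta\in\mathbb{C}$, let $m(\beta)$ be the order of vanishing of $f'$ at $\beta$. Then there exists a tree $\mathcal{G}$ such that: (i) its vertex set is $A$; (ii) it has $s-1$ edges, each indexed by an element of $B$; (iii) for each $\beta\in B$, exactly $m(\beta)$ edges are indexed by $\beta$; (iv) if $\{\alpha,\alpha'\}$ is an edge indexed by $\beta$, there is a path $\gamma:[0,1]\to\mathbb{C}$ of length at most $2\pi RN$, with image contained in $\mathcal{K}$, such that $\gamma(0)=\alpha$, $\gamma(1)=\alpha'$, $\gamma(1/2)=\beta$ and $\max_{0\le t\le1}|f(\gamma(t))|=|f(\beta)|$.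
   Context: A path is a continuous, piecewise differentiable map from a closed interval of $\mathbb{R}$ to $\mathbb{C}$. A graph is a pair $(V,E)$ of finite sets with $E$ a set of 2-element subsets of $V$; it is a tree if any two distinct vertices are joined by exactly one elementary chain (sequence of distinct vertices with consecutive ones forming edges). ''Edges indexed by elements of $B$'' means a labelling map from the edge set to $B$. *)

(* Defs.v *)
From HB Require Import structures.
From mathcomp Require Import all_boot all_order all_algebra finmap complex.
From mathcomp Require Import all_classical all_reals all_analysis.

Set Implicit Arguments.
Unset Strict Implicit.
Unset Printing Implicit Defensive.

Import Order.TTheory GRing.Theory Num.Theory.
Import numFieldNormedType.Exports.

Local Open Scope fset_scope.
Local Open Scope classical_set_scope.
Local Open Scope complex_scope.
Local Open Scope ring_scope.

Record graph (T : choiceType) := Graph {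
  vertices : {fset T};
  edges : {fset {fset T}};
  edges_subset : forall e, e \in edges -> (e `<=` vertices)%fset;
  edges_card2 : forall e, e \in edges -> #|` e| = 2%N }.

Definition adjacent (T : choiceType) (G : graph T) : rel T :=
  fun x y => [fset x; y]%fset \in edges G.

(* The chain is the sequence x :: p. *)
Definition elementary_chain (T : choiceType) (G : graph T) (x y : T)
    (p : seq T) : Prop :=
  [/\ {subset x :: p <= vertices G}, uniq (x :: p), path (adjacent G) x p
    & last x p = y].

Definition is_tree (T : choiceType) (G : graph T) : Prop :=
  forall x y, x \in vertices G -> y \in vertices G -> x != y ->
    exists! p : seq T, elementary_chain G x y p.

Section ComplexPaths.
Variable R : realType.

(* The regular algebra R[i]^o carries the usual topology of the complex plane;
   Rcomplex R is R[i] as a vector space over R. *)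

Definition differentiable_on_itv (a b : R) (g : R -> R[i]) : Prop :=
  forall t, t \in `[a, b] -> exists l : R[i]^o,
    (fun u => (g u - g t) / (u - t)%:C : R[i]^o) @ within `[a, b] t^' --> l.

(* At the subdivision points the two one-sided derivatives may differ. *)
Definition piecewise_differentiable (a b : R) (g : R -> R[i]) : Prop :=
  exists2 s : seq R, itv_partition a b s &
    forall i, (i < size s)%N ->
      differentiable_on_itv (nth b (a :: s) i) (nth b s i) g.

(* Only the values of g on `[a, b] matter. *)
Definition is_path (a b : R) (g : R -> R[i]) : Prop :=
  {within `[a, b], continuous (g : R -> R[i]^o)} /\
  piecewise_differentiable a b g.

(* The length of a curve is the supremum of the lengths of the inscribed
   polygonal lines. *)
Definition path_length (a b : R) (g : R -> R[i]) : \bar R :=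
  ereal_sup [set (\sum_(0 <= i < size s)
                    Normc.normc (g (nth b s i) - g (nth b (a :: s) i)))%:E
            | s in itv_partition a b].

Definition convex_hull (A : set R[i]) : set R[i] :=
  smallest (@convex_set R (Rcomplex R)) A.

Definition is_maximum (S : set R) (M : R) : Prop := S M /\ ubound S M.

End ComplexPaths.

(* Main.v *)
(* For a critical point b outside the zero set, lift the segment [0, f(b)]
   through f, starting at b: every lift descends to a root. Lifts exist from
   every point and are closed under limits: consecutive nearest roots of
   f - s f(b) give approximate lifts, and a connected piece of a lemniscate
   |f - v| <= d^N lies in N disks of radius d, hence has diameter at most 2 N d,
   which makes all lifts equicontinuous. Just below b the lifts of b take at most
   m(b) + 1 values. Joining the end of one of them to the ends of the others,
   except when the two lifts meet again, uses at most m(b) edges indexed by b.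

   All lifts of a given point end in the same component of the resulting graph,
   by induction on |f|, so that a component defines a closed set of starting
   points. The plane being connected, the graph is connected. It has s vertices
   and at most sum m(b) = s - 1 edges: it is a tree and all bounds are equalities.

   A path from a to a' through b is made of two lifts meeting only at b. It is an
   injective curve inside Im(f / f(b)) = 0, hence meets every line at most N times
   for all but finitely many directions. Projecting on two orthogonal directions
   bounds its length by 4 R N <= 2 pi R N. It stays in the convex hull by the Gauss-Lucas argument, and
   becomes differentiable at critical levels after a polynomial change of
   parameter that is flat there. *)
Require Import Defs.
From HB Require Import structures.
From mathcomp Require Import all_boot all_order all_algebra finmap complex.
From mathcomp Require Import all_classical all_reals all_analysis.
From mathcomp Require Import measurable_realfun ring lra zify.

Set Implicit Arguments.
Unset Strict Implicit.
Unset Printing Implicit Defensive.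

Import Order.TTheory GRing.Theory Num.Theory.
Import numFieldNormedType.Exports.

Local Open Scope fset_scope.
Local Open Scope classical_set_scope.
Local Open Scope complex_scope.
Local Open Scope ring_scope.

Import Normc.

Local Notation re := complex.Re.
Local Notation im := complex.Im.

(** * Complex modulus and near roots *)

Section Normc.
Variable R : realType.
Implicit Types (x y z : R[i]) (a : R).

(** No branch of an inverse of [f] is constructed: the metric input is that the modulus of a monic
    polynomial at a point is the product of the distances to its roots. The price is that lifts are
    not known to behave like analytic arcs. In particular two lifts that part at [b] might meet
    again lower down; the maximum principle could exclude this, but it is not invoked. The case
    disappears only with the final count, where connectivity forces as many edges as the
    multiplicities allow. The constant 4 in the length comes from two orthogonal directions, in each
    of which the curve projects into an interval of length [2 R] and takes each value at most [N]
    times. Exceptional directions are those for which the imaginary part of [f / f(b)], restricted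
    to a line, has degree less than [N]. *)

Lemma normc_ge0 x : 0 <= normc x.
Proof. by case: x => a b; exact: sqrtr_ge0. Qed.

Lemma normcE x : (normc x)%:C = `|x|.
Proof. by []. Qed.

Lemma normcD x y : normc (x + y) <= normc x + normc y.
Proof. exact: le_normcD. Qed.

Lemma normcNE x : normc (- x) = normc x.
Proof. exact: normcN. Qed.

Lemma normcBC x y : normc (x - y) = normc (y - x).
Proof. by rewrite -normcN opprB. Qed.

Lemma normc_triangle y x z : normc (x - z) <= normc (x - y) + normc (y - z).
Proof. by rewrite -(subrKA y) normcD. Qed.

Lemma normcR a : normc a%:C = `|a|.
Proof. by rewrite /normc /= expr0n /= addr0 sqrtr_sqr. Qed.

Lemma normc0P x : (normc x == 0) = (x == 0).
Proof.
by apply/eqP/eqP => [/eq0_normc//|->]; exact: normc0.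
Qed.

Lemma normc_gt0 x : (0 < normc x) = (x != 0).
Proof. by rewrite lt_def normc_ge0 andbT normc0P. Qed.

Lemma normcX x n : normc (x ^+ n) = normc x ^+ n.
Proof. by elim: n => [|n IH]; rewrite ?expr0 ?normc1// !exprS normcM IH. Qed.

Lemma normc_prod (I : Type) (s : seq I) (P : pred I) (F : I -> R[i]) :
  normc (\prod_(i <- s | P i) F i) = \prod_(i <- s | P i) normc (F i).
Proof. exact: (big_morph _ (@normcM R) (normc1 R)). Qed.

Lemma Re_le_normc x : `|re x| <= normc x.
Proof. by rewrite -lecR; exact: normc_ge_Re. Qed.

Lemma Im_le_normc x : `|im x| <= normc x.
Proof.
by case: x => a b /=; rewrite -sqrtr_sqr ler_wsqrtr// lerDr sqr_ge0.
Qed.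

Lemma normc_le_ReIm x : normc x <= `|re x| + `|im x|.
Proof.
have {1}-> : x = (re x)%:C + 'i * (im x)%:C by rewrite -complexE.
rewrite (le_trans (normcD _ _))// normcM !normcR.
by rewrite /normc /= expr0n add0r expr1n sqrtr1 mul1r.
Qed.

Lemma normc_le_eq0 x : (forall e : R, 0 < e -> normc x <= e) -> x = 0.
Proof.
move=> h; apply/eqP; rewrite -normc0P eq_le normc_ge0 andbT.
by apply/ler_addgt0Pr => e e0; rewrite add0r; exact: h.
Qed.

End Normc.

Section Roots.
Variable R : realType.
Implicit Types (p : {poly R[i]}) (x : R[i]).

Lemma monic_split p : p \is monic -> exists2 rs : seq R[i],
  p = \prod_(z <- rs) ('X - z%:P) & size rs = (size p).-1.
Proof.
move=> pm; have [rs prs] := closed_field_poly_normal p.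
move: prs; rewrite (monicP pm) scale1r => prs; exists rs => //.
by rewrite prs size_prod_XsubC.
Qed.

(** [normc p.[x]] is the product of the distances from [x] to the roots; were all of them larger
    than [d], it would exceed [d ^+ (size p).-1]. *)
Lemma near_root p x (d : R) : p \is monic -> 0 <= d -> (1 < size p)%N ->
  normc p.[x] <= d ^+ (size p).-1 ->
  exists2 r, root p r & normc (x - r) <= d.
Proof.
move=> pm d0 sp; have [rs prs <-] := monic_split pm => h.
have srs : size rs != 0%N by apply/eqP => s0; move: sp; rewrite prs size_prod_XsubC s0.
have [/hasP[r rrs hr]|/hasPn H] := boolP (has (fun r => normc (x - r) <= d) rs).
  by exists r => //; rewrite prs root_prod_XsubC.
suff : d ^+ size rs < normc p.[x] by rewrite ltNge h.
rewrite prs horner_prod normc_prod.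
have -> : d ^+ size rs = \prod_(z <- rs) d.
  by rewrite big_const_seq count_predT iter_mulr_1.
have {}srs : has predT rs by rewrite has_predT lt0n.
rewrite big_seq [X in _ < X]big_seq; apply: ltr_prod.
  by apply/hasP; case/hasP: srs => y yrs _; exists y.
by move=> i irs; rewrite d0/= hornerXsubC ltNge; exact: H.
Qed.

End Roots.

(* An [e]-chain leaves the ball containing its first point for good after
   finitely many steps; the rest of the chain avoids that ball. *)
Lemma chain_diam (R : realType) (d e : R) (cs : seq R[i]) (z : nat -> R[i])
    (i k : nat) : 0 <= d -> 0 <= e -> (i <= k)%N ->
  (forall j, (i <= j < k)%N -> normc (z j.+1 - z j) <= e) ->
  (forall j, (i <= j <= k)%N -> exists2 c, c \in cs & normc (z j - c) <= d) ->
  normc (z k - z i) <= (size cs)%:R * (2 * d + e).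
Proof.
move=> d0 e0; move sn : (size cs) => n.
elim: n cs sn i => [|n IH] cs sn i ik step ball.
  by have [|c] := ball i; rewrite ?leqnn// (size0nil sn).
have [|c ccs zic] := ball i; first by rewrite leqnn.
pose P j := (i <= j <= k)%N && (normc (z j - c) <= d).
have exP : exists j, P j by exists i; rewrite /P leqnn ik.
have ubP j : P j -> (j <= k)%N by case/andP => /andP[].
case: (ex_maxnP exP ubP) => l /andP[/andP[il lk] zlc] lmax.
have h1 : normc (z l - z i) <= 2 * d.
  by have := normc_triangle c (z l) (z i); rewrite (normcBC c); lra.
have [/eqP kl|kl] := boolP (k == l).
  have : 0 <= n%:R * (2 * d + e) by rewrite mulr_ge0// addr_ge0// mulr_ge0.
  rewrite kl -natr1 mulrDl mul1r; lra.
have {kl}lk' : (l < k)%N by rewrite ltn_neqAle eq_sym kl.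
have H : normc (z k - z l.+1) <= n%:R * (2 * d + e).
  apply: (IH (rem c cs)) => //.
  - by rewrite size_rem// sn.
  - by move=> j /andP[lj jk]; apply: step; rewrite jk andbT; lia.
  - move=> j /andP[lj jk]; have [|c' c'cs h] := ball j; first by rewrite jk andbT; lia.
    exists c' => //; have [cc'|cc'] := eqVneq c' c.
      have : P j by rewrite /P jk -cc' h !andbT; lia.
      by move/lmax; lia.
    by move: c'cs; rewrite (perm_mem (perm_to_rem ccs)) inE (negbTE cc').
have h2 : normc (z l.+1 - z l) <= e by apply: step; rewrite il lk'.
have h3 := normc_triangle (z l.+1) (z k) (z i).
have h4 := normc_triangle (z l) (z l.+1) (z i).
rewrite -natr1 mulrDl mul1r; lra.
Qed.

(** A cluster point is a limit because an ultrafilter decides each neighbourhood. One ultrafilter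
    serves all functions, so limits at uncountably many parameters need no extraction of
    subsequences. *)
Lemma ultralimit (R : realType) (T : Type) (U : set_system T) (h : T -> R)
    (M : R) : UltraFilter U -> (forall t, `|h t| <= M) ->
  exists l, forall e, 0 < e -> U [set t | `|h t - l| <= e].
Proof.
move=> UU hM.
have hF : (h @ U) `[- M, M]%classic.
  apply: (@filterS _ U _ setT); last exact: filterT.
  by move=> t _ /=; rewrite in_itv/= -ler_norml hM.
have [l [_ /= cl]] := @segment_compact R (- M) M (h @ U) _ hF.
exists l => e e0.
have [//|V] := in_ultra_setVsetC [set t | `|h t - l| <= e] UU.
have [|//|x []] := cl [set x | e < `|x - l| ] (ball l e).
- apply: (filterS (P := ~` [set t | `|h t - l| <= e])) => //= t /=.
  by rewrite ltNge => /negP.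
- exact: nbhsx_ballx.
- by move=> /= ex; rewrite /ball /= distrC ltNge (ltW ex).
Qed.

Lemma ultralimitc (R : realType) (T : Type) (U : set_system T)
    (h : T -> R[i]) (M : R) : UltraFilter U -> (forall t, normc (h t) <= M) ->
  exists l, forall e, 0 < e -> U [set t | normc (h t - l) <= e].
Proof.
move=> UU hM.
have [t|a ha] := @ultralimit R T U (fun t => re (h t)) M UU.
  exact: le_trans (Re_le_normc _) (hM t).
have [t|b hb] := @ultralimit R T U (fun t => im (h t)) M UU.
  exact: le_trans (Im_le_normc _) (hM t).
exists (a +i* b) => e e0; have e2 : 0 < e / 2 by rewrite divr_gt0.
apply: filterS2 (ha _ e2) (hb _ e2) => t /= h1 h2.
rewrite (le_trans (normc_le_ReIm _))// [leRHS]splitr lerD//.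
  by case: (h t) h1.
by case: (h t) h2.
Qed.

(** * Lifts of segments *)

Section Polynomials.
Variable R : realType.
Implicit Types (p f : {poly R[i]}) (x y z v : R[i]).

Lemma poly_bounded p (M : R) :
  exists2 B, 0 <= B & forall y, normc y <= M -> normc p.[y] <= B.
Proof.
elim/poly_ind: p => [|p c [B B0 hB]].
  by exists 0 => // y _; rewrite horner0 normc0.
exists (B * `|M| + normc c) => [|y yM].
  by rewrite addr_ge0 ?mulr_ge0 ?normc_ge0.
rewrite hornerMXaddC (le_trans (normcD _ _))// lerD2r normcM.
by rewrite ler_pM ?normc_ge0 ?hB// (le_trans yM) ?ler_norm.
Qed.

(** [q] is the difference quotient of [p] at [x]; with it, continuity of a polynomial replaces the
    limit that defines the derivative. *)
Lemma poly_factor p x :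
  exists2 q, p - p.[x]%:P = q * ('X - x%:P) & q.[x] = p^`().[x].
Proof.
have /factor_theorem[q pq] : root (p - p.[x]%:P) x.
  by rewrite /root !hornerE subrr.
exists q => //; have := congr1 (fun p => p^`().[x]) pq.
rewrite poly.derivB poly.derivC subr0 poly.derivM poly.derivXsubC !hornerE.
by rewrite subrr mulr0 add0r.
Qed.

Lemma poly_lip p x (M : R) : exists2 B, 0 <= B &
  forall y, normc y <= M -> normc (p.[y] - p.[x]) <= B * normc (y - x).
Proof.
have [q pq _] := poly_factor p x; have [B B0 hB] := poly_bounded q M.
exists B => // y yM; have -> : p.[y] - p.[x] = q.[y] * (y - x).
  by have := congr1 (horner^~ y) pq; rewrite !hornerE.
by rewrite normcM ler_wpM2r ?normc_ge0 ?hB.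
Qed.

Lemma poly_cts p x (e : R) : 0 < e -> exists2 d, 0 < d &
  forall y, normc (y - x) <= d -> normc (p.[y] - p.[x]) <= e.
Proof.
move=> e0; have [B B0 hB] := poly_lip p x (normc x + 1).
exists (Num.min 1 (e / (B + 1))) => [|y].
  by rewrite lt_min ltr01 divr_gt0// ltr_wpDl.
rewrite le_min => /andP[y1 ye].
have yM : normc y <= normc x + 1.
  by have := normcD (y - x) x; rewrite subrK; lra.
rewrite (le_trans (hB _ yM))// (@le_trans _ _ ((B + 1) * normc (y - x)))//.
  by rewrite ler_wpM2r ?normc_ge0// lerDl.
by rewrite mulrC -ler_pdivlMr// ltr_wpDl.
Qed.

Lemma size_subC f v : (1 < size f)%N -> size (f - v%:P) = size f.
Proof.
by move=> f1; rewrite size_polyDl// size_polyN (leq_ltn_trans (size_polyC_leq1 _)).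
Qed.

Lemma monic_subC f v : (1 < size f)%N -> f \is monic -> f - v%:P \is monic.
Proof.
move=> f1 fm; rewrite monicE lead_coefDl -?monicE//.
by rewrite size_polyN (leq_ltn_trans (size_polyC_leq1 _)).
Qed.

Lemma near_preimage f x v (d : R) : f \is monic -> (1 < size f)%N -> 0 <= d ->
  normc (f.[x] - v) <= d ^+ (size f).-1 ->
  exists2 y, f.[y] = v & normc (x - y) <= d.
Proof.
move=> fm f1 d0 h; have [|||y fy xy] := @near_root R (f - v%:P) x d _ d0.
- exact: monic_subC.
- by rewrite size_subC.
- by rewrite size_subC// !hornerE.
exists y => //; apply/eqP; rewrite -subr_eq0.
by move: fy; rewrite /root !hornerE.
Qed.

End Polynomials.

(** * Approximate lifts along a subdivision *)

Section Lifts.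
Variables (R : realType) (f : {poly R[i]}).
Hypotheses (fm : f \is monic) (f1 : (1 < size f)%N).
Local Notation N := (size f).-1.
Implicit Types (z w : R[i]) (g : R -> R[i]) (e d s t : R).

(* [g] is a lift through [f] of the segment from [0] to [f.[g 1]], read so that
   [g 0] is a root; the second condition is a quantitative form of
   N^-1-Hoelder continuity that needs no N-th root. *)
Definition is_lift g :=
  (forall s, 0 <= s <= 1 -> f.[g s] = s%:C * f.[g 1]) /\
  (forall s t d, 0 <= s <= 1 -> 0 <= t <= 1 -> 0 <= d ->
    normc f.[g 1] * `|s - t| <= d ^+ N -> normc (g s - g t) <= N%:R * (2 * d)).

(** A lift of [z] up to an error [e]: step functions are allowed, and [2 * d + e] is the diameter of
    a disk plus a jump. *)
Definition approx_lift e z g :=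
  [/\ normc (g 1 - z) <= e,
      forall s, 0 <= s <= 1 -> normc (f.[g s] - s%:C * f.[z]) <= e &
      forall s t d, 0 <= s <= 1 -> 0 <= t <= 1 -> 0 <= d ->
        normc f.[z] * `|s - t| + e <= d ^+ N ->
        normc (g s - g t) <= N%:R * (2 * d + e)].

Lemma approx_lift_exists z e : 0 < e -> exists g, approx_lift e z g.
Proof.
move=> e0; set w := f.[z].
(* [e ^+ N] lets the next preimage be found within [e]; [e] itself absorbs the rounding of a
   parameter to the subdivision. *)
pose e1 := Num.min (e ^+ N) e.
have e10 : 0 < e1 by rewrite lt_min e0 exprn_gt0.
pose n := (Num.truncn (normc w / e1)).+1.
have n0 : 0 < n%:R :> R by rewrite ltr0n.
have hn : normc w / n%:R <= e1.
  rewrite ler_pdivrMr// mulrC -ler_pdivrMr//.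
  have /truncn_itv/andP[_ /ltW//] : 0 <= normc w / e1.
  by rewrite divr_ge0 ?normc_ge0 ?ltW.
(* The subdivision runs downwards, from [w] at index 0 to 0 at index [n]; hence the [1 - s] in [J]
   below. *)
pose v j : R[i] := (1 - j%:R / n%:R)%:C * w.
have vB j k : normc (v j - v k) = normc w * (`|j%:R - k%:R| / n%:R).
  rewrite /v -mulrBl normcM mulrC -rmorphB normcR.
  rewrite (_ : _ - _ = (k%:R - j%:R) / n%:R); last by ring.
  by rewrite normrM distrC (@ger0_norm _ n%:R^-1)// invr_ge0 ltW.
have /choice[F hF] : forall jy : nat * R[i], exists x : R[i],
    f.[jy.2] = v jy.1 -> f.[x] = v jy.1.+1 /\ normc (x - jy.2) <= e.
  move=> [j y] /=; have [fy|fy] := eqVneq f.[y] (v j); last first.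
    by exists 0 => h; rewrite h eqxx in fy.
  have [|x fx xy] := near_preimage (v := v j.+1) (x := y) fm f1 (ltW e0).
  - rewrite fy vB -natr1 opprD addrA subrr sub0r normrN1 mul1r.
    by rewrite (le_trans hn)// ge_min lexx.
  - by exists x => _; rewrite normcBC.
pose zz := fix zz j := if j is j'.+1 then F (j', zz j') else z.
have fzz j : f.[zz j] = v j.
  elim: j => [|j IH]; first by rewrite /v mul0r subr0 mul1r.
  by have [] := hF (j, zz j) IH.
have szz j : normc (zz j.+1 - zz j) <= e by have [] := hF (j, zz j) (fzz j).
pose J s := Num.truncn (n%:R * (1 - s)).
have hJ s : 0 <= s <= 1 -> (J s)%:R <= n%:R * (1 - s) < (J s)%:R + 1.
  move=> /andP[s0 s1]; rewrite natr1 /J truncn_itv//.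
  by rewrite mulr_ge0 ?ler0n ?subr_ge0.
have vJ s : 0 <= s <= 1 -> normc (v (J s) - s%:C * w) <= e.
  move=> s01; rewrite /v -mulrBl -rmorphB normcM normcR.
  rewrite (le_trans _ (le_trans hn _)) ?ge_min ?lexx ?orbT//.
  rewrite mulrC ler_wpM2l ?normc_ge0// -[leRHS]mul1r ler_pdivlMr//.
  have hn1 : (1 - (J s)%:R / n%:R - s) * n%:R = n%:R * (1 - s) - (J s)%:R.
    by rewrite 2!mulrBl mul1r divfK ?gt_eqF// mulrBr mulr1 addrAC (mulrC s).
  have := normrM (1 - (J s)%:R / n%:R - s) n%:R.
  rewrite hn1 (ger0_norm (ltW n0)) => <-.
  by have /andP[h1 h2] := hJ s s01; rewrite ger0_norm; lra.
exists (fun s => zz (J s)); split.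
- by rewrite /J subrr mulr0 truncn0 subrr normc0 ltW.
- by move=> s s01; rewrite fzz vJ.
move=> s t d s01 t01 d0.
wlog st : s t s01 t01 / (J t <= J s)%N.
  have [ts|/ltnW st] := leqP (J t) (J s) => H h; first exact: H.
  by rewrite normcBC; apply: H => //; rewrite distrC.
(* Between the indices [J t] and [J s] the chain stays within [d] of the roots [cs] of
   [f - v (J t)], as [v] varies there by at most [normc w] times [|s - t| + 1 / n]. *)
move=> h; have [cs cse scs] := monic_split (monic_subC (v (J t)) f1 fm).
rewrite size_subC// in scs; rewrite -scs.
apply: (@chain_diam _ d e cs zz _ _ d0 (ltW e0) st) => [j _|j /andP[tj js]].
  exact: szz.
have [] := @near_root _ (f - (v (J t))%:P) (zz j) d.
- exact: monic_subC.
- exact: d0.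
- by rewrite size_subC.
- rewrite size_subC// !hornerE fzz vB.
  have hst : `|j%:R - (J t)%:R| / n%:R <= `|s - t| + n%:R^-1.
    rewrite ger0_norm ?subr_ge0 ?ler_nat// ler_pdivrMr// mulrDl mulVf ?gt_eqF//.
    have : j%:R <= (J s)%:R :> R by rewrite ler_nat.
    have /andP[h1 h2] := hJ s s01; have /andP[h3 h4] := hJ t t01.
    have h5 : t - s <= `|s - t| by rewrite distrC ler_norm.
    have : (t - s) * n%:R <= `|s - t| * n%:R by exact: ler_wpM2r (ltW n0) _ _ h5.
    lra.
  apply: le_trans (ler_wpM2l (normc_ge0 _) hst) (le_trans _ h).
  by rewrite mulrDr lerD2l (le_trans hn)// ge_min lexx orbT.
- move=> r; rewrite cse root_prod_XsubC => rcs hr; by exists r.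
Qed.

End Lifts.

(** * Limits of approximate lifts: existence and closedness *)

Section LiftCompactness.
Variables (R : realType) (f : {poly R[i]}).
Hypotheses (fm : f \is monic) (f1 : (1 < size f)%N).
Local Notation N := (size f).-1.
Implicit Types (z w a : R[i]) (g : R -> R[i]) (e d s t : R).

(** Enlarging a radius from [d] to [d + e] makes room for an additional error [e ^+ N] without
    extracting roots. *)
Lemma ler_exprD_le d e n : 0 <= d -> 0 <= e ->
  d ^+ n.+1 + e ^+ n.+1 <= (d + e) ^+ n.+1.
Proof.
move=> d0 e0; elim: n => [|n IH]; first by rewrite !expr1.
rewrite [leRHS]exprS (le_trans _ (ler_wpM2l _ IH)) ?addr_ge0//.
rewrite mulrDr !mulrDl -!exprS addrA lerD2r -addrA lerDl.
by rewrite addr_ge0 ?mulr_ge0 ?exprn_ge0.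
Qed.

Lemma inv_nat_small (u := fun n : nat => n.+1%:R^-1 : R) :
  (forall n, 0 < u n <= 1) /\
  (forall e, 0 < e -> \forall n \near \oo, u n <= e).
Proof.
split=> [n|e e0]; first by rewrite /u invr_gt0 ltr0Sn invf_le1 ?ler1n.
by have := near_infty_natSinv_lt (PosNum e0); apply: filterS => n /= /ltW.
Qed.

(** The limit is pointwise along one ultrafilter; it inherits the continuity estimate because that
    estimate is uniform. The clause on [g' 0] serves to show that the points having a lift that ends
    at [a] form a closed set. *)
Lemma approx_lift_limit z (u : nat -> R) (g : nat -> R -> R[i]) :
  (forall n, 0 < u n <= 1) ->
  (forall e, 0 < e -> \forall n \near \oo, u n <= e) ->
  (forall n, approx_lift f (u n) z (g n)) ->
  exists2 g', is_lift f g' & g' 1 = z /\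
    forall a, (forall n, normc (g n 0 - a) <= u n) -> g' 0 = a.
Proof.
move=> u01 ucvg ag; have [U [UU ooU]] := ultraFilterLemma eventually_filter.
have Usmall e : 0 < e -> U [set n | u n <= e].
  by move=> /ucvg; exact: ooU.
have N0 : (0 < N)%N by case: (size f) f1 => [|[]].
have i1 : 0 <= (1 : R) <= 1 by rewrite ler01 lexx.
have i0 : 0 <= (0 : R) <= 1 by rewrite ler01 lexx.
have inv1 n : u n <= 1 by case/andP: (u01 n).
have inv0 n : 0 < u n by case/andP: (u01 n).
have lim s : exists l, 0 <= s <= 1 ->
    forall e, 0 < e -> U [set n | normc (g n s - l) <= e].
  have [s01|] := boolP (0 <= s <= 1); last by exists 0.
  (* As [d >= 1], this radius is admissible between the parameters [s] and 1, so the values at [s]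
     stay within a fixed distance of [z]. *)
  set d := normc f.[z] + 1; have d1 : 1 <= d by rewrite lerDr normc_ge0.
  have d0 : 0 <= d by rewrite (le_trans ler01).
  have [n|l hl] := @ultralimitc R _ U (g^~ s)
      (normc z + 1 + N%:R * (2 * d + 1)) UU; last by exists l.
  have [h1 _ /(_ s 1 d s01 i1 d0)] := ag n.
  have h2 : normc f.[z] * `|s - 1| + u n <= d ^+ N.
    apply: (@le_trans _ _ d); last by rewrite ler_eXnr.
    rewrite lerD// -[leRHS]mulr1 ler_wpM2l ?normc_ge0//.
    by case/andP: s01 => s0 s1; rewrite distrC ger0_norm; lra.
  move=> /(_ h2) h3.
  have h4 : N%:R * (2 * d + u n) <= N%:R * (2 * d + 1) :> R.
    by rewrite ler_wpM2l// lerD2l.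
  have := normcD (g n 1 - z) z; rewrite subrK => h5.
  have := normcD (g n s - g n 1) (g n 1); rewrite subrK => h6.
  have h7 := le_trans h1 (inv1 n); have h8 := le_trans h3 h4.
  by move=> {h1 h2 h3 h4 d1 d0} /=; lra.
have /choice[h hh] := lim.
have hR s : 0 <= s <= 1 -> f.[h s] = s%:C * f.[z].
  move=> s01; apply/eqP; rewrite -subr_eq0; apply/eqP/normc_le_eq0 => e e0.
  have e2 : 0 < e / 2 by rewrite divr_gt0.
  have [d d0 hd] := poly_cts f (h s) e2.
  have [n [/= n1 n2]] := filter_ex (filterI (hh s s01 d d0) (Usmall _ e2)).
  have [_ /(_ s s01) h1 _] := ag n.
  have := normc_triangle f.[g n s] f.[h s] (s%:C * f.[z]).
  by rewrite (normcBC f.[h s] f.[g n s]); have := hd _ n1; lra.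
have h1z : h 1 = z.
  apply/eqP; rewrite -subr_eq0; apply/eqP/normc_le_eq0 => e e0.
  have e2 : 0 < e / 2 by rewrite divr_gt0.
  have [n [/= n1 n2]] := filter_ex (filterI (hh 1 i1 _ e2) (Usmall _ e2)).
  have [h1 _ _] := ag n.
  by have := normc_triangle (g n 1) (h 1) z; rewrite (normcBC (h 1) (g n 1)); lra.
exists h; first split.
- by move=> s s01; rewrite h1z hR.
- move=> s t d s01 t01 d0; rewrite h1z => hst.
  (* [e'] is spent once at each end and [3 * N] times in the estimate: [2 * e'] for the larger
     radius and [e'] for the jump, in each of [N] disks. *)
  apply/ler_addgt0Pr => e e0. pose e' := e / (2 + 3 * N%:R).
  have c0 : 0 < 2 + 3 * N%:R :> R by rewrite ltr_pwDl// mulr_ge0.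
  have e'0 : 0 < e' by rewrite divr_gt0.
  have [n [[/= n1 n2] [n3 n4]]] := filter_ex (filterI
    (filterI (hh s s01 _ e'0) (hh t t01 _ e'0))
    (filterI (Usmall _ e'0) (Usmall _ (exprn_gt0 N e'0)))).
  have de0 : 0 <= d + e' by rewrite addr_ge0// (ltW e'0).
  have [_ _ /(_ s t (d + e') s01 t01 de0) H] := ag n.
  have {}H : normc (g n s - g n t) <= N%:R * (2 * (d + e') + u n).
    apply: H; case: (N) N0 hst n4 => // m _ hst n4.
    by rewrite (le_trans _ (ler_exprD_le _ _ _)) ?(ltW e'0)// lerD.
  have ee' : e = 2 * e' + N%:R * (3 * e').
    by transitivity (e' * (2 + 3 * N%:R)); [rewrite divfK ?gt_eqF|ring].
  have h3 : N%:R * (2 * (d + e') + u n) <=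
      N%:R * (2 * d) + N%:R * (3 * e') :> R.
    by rewrite -mulrDr ler_wpM2l//; lra.
  have := normc_triangle (g n s) (h s) (h t); rewrite (normcBC (h s) (g n s)).
  by have := normc_triangle (g n t) (g n s) (h t); lra.
- split=> // a ha; apply/eqP; rewrite -subr_eq0; apply/eqP/normc_le_eq0 => e e0.
  have e2 : 0 < e / 2 by rewrite divr_gt0.
  have [n [/= n1 n2]] := filter_ex (filterI (hh 0 i0 _ e2) (Usmall _ e2)).
  have := ha n.
  by have := normc_triangle (g n 0) (h 0) a; rewrite (normcBC (h 0) (g n 0)); lra.
Qed.

Lemma lift_exists z : exists2 g, is_lift f g & g 1 = z.
Proof.
have /choice[g hg] n : exists g, approx_lift f n.+1%:R^-1 z g.
  by apply: approx_lift_exists; rewrite // invr_gt0.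
by have [g' lg' [g'1 _]] := approx_lift_limit inv_nat_small.1 inv_nat_small.2 hg; exists g'.
Qed.

(** A lift of a point close to [z] is an approximate lift of [z], with an error given by the
    continuity of [f] at [z]. *)
Lemma lift_closed z a :
  (forall e, 0 < e -> exists g,
     [/\ is_lift f g, normc (g 1 - z) <= e & g 0 = a]) ->
  exists g, [/\ is_lift f g, g 1 = z & g 0 = a].
Proof.
move=> H.
have /choice[g hg] (n : nat) : exists g, approx_lift f n.+1%:R^-1 z g /\ g 0 = a.
  have n0 : 0 < n.+1%:R^-1 :> R by rewrite invr_gt0.
  have [d d0 hd] := poly_cts f z n0.
  have [|g [[g1 g2] gz g0]] := H (Num.min n.+1%:R^-1 d); first by rewrite lt_min n0.
  move: gz; rewrite le_min => /andP[gn /hd gd].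
  exists g; split => //; split => // [s s01|s t e s01 t01 e0 h].
    rewrite g1// -mulrBr normcM normcR (le_trans _ gd)// ler_piMl ?normc_ge0//.
    by case/andP: s01 => s0 s1; rewrite ger0_norm.
  rewrite (le_trans (g2 s t e s01 t01 e0 _))//; last first.
    by rewrite ler_wpM2l// lerDl.
  apply: le_trans h; rewrite -lerBlDl -mulrBl.
  have st1 : `|s - t| <= 1.
    by case/andP: s01 => s0 s1; case/andP: t01 => t0 t1; rewrite ler_norml; lra.
  have := normcD (f.[g 1] - f.[z]) f.[z]; rewrite subrK => h1.
  have h2 : (normc f.[g 1] - normc f.[z]) * `|s - t| <= n.+1%:R^-1 * `|s - t|.
    by rewrite ler_wpM2r// lerBlDr (le_trans h1)// lerD2r.
  by rewrite (le_trans h2)// ler_piMr// ltW.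
have [g' lg' [g'1 g'0]] := approx_lift_limit inv_nat_small.1 inv_nat_small.2
  (fun n => (hg n).1).
by exists g'; split=> //; apply: g'0 => n; rewrite (hg n).2 subrr normc0.
Qed.

(** The Hoelder estimate involves only [normc f.[g 1] * |s - t|], the distance between two values of
    [f], so it survives restriction and rescaling. *)
Lemma lift_tail g s : is_lift f g -> 0 <= s <= 1 ->
  is_lift f (fun t => g (s * t)).
Proof.
move=> [g1 g2] s01; case/andP: (s01) => s0 s1.
have st t : 0 <= t <= 1 -> 0 <= s * t <= 1.
  by case/andP => t0 t1; rewrite mulr_ge0 ?mulr_ile1.
split=> [t t01|t t' d t01 t'01 d0 h].
  by rewrite mulr1 g1 ?st// (g1 s)// rmorphM/= mulrA (mulrC s%:C).
apply: g2; rewrite ?st// -mulrBr normrM (ger0_norm s0) mulrA.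
by move: h; rewrite mulr1 g1// normcM normcR (ger0_norm s0) (mulrC s).
Qed.

End LiftCompactness.

(** * Lifts near a critical point *)

Section LocalCount.
Variables (R : realType) (f : {poly R[i]}).
Hypotheses (fm : f \is monic) (f1 : (1 < size f)%N).
Local Notation N := (size f).-1.
Implicit Types (b z w x y : R[i]) (g : R -> R[i]) (e d s t : R).

(** Characteristic zero makes the derivative lose exactly one order: the factor [k.+1] does not
    vanish. *)
Lemma mup_deriv (p : {poly R[i]}) b : p != 0 -> root p b ->
  exists2 q, p = q * ('X - b%:P) ^+ (mup b p^`()).+1 & q.[b] != 0.
Proof.
move=> p0 pb; have [[|k] [q + pq]] := multiplicity_XsubC p b.
  by rewrite p0/=; move: pb; rewrite pq expr0 mulr1 => ->.
rewrite p0/= => qb; exists q => //.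
suff -> : mup b p^`() = k by [].
have -> : p^`() = (q^`() * ('X - b%:P) + q *+ k.+1) * ('X - b%:P) ^+ k.
  rewrite pq poly.derivM poly.deriv_exp poly.derivXsubC mul1r /=.
  by rewrite mulrDl -mulrA -exprS mulrnAr mulrnAl.
rewrite mupMr ?mup_XsubCX ?eqxx//.
rewrite /root !hornerE subrr mulr0 add0r hornerMn mulrn_eq0/=.
exact: qb.
Qed.

Lemma roots_bounded (p : {poly R[i]}) : p \is monic ->
  exists M, forall r, root p r -> normc r <= M.
Proof.
move=> pm; have [rs -> _] := monic_split pm.
exists (\sum_(r <- rs) normc r) => r; rewrite root_prod_XsubC => rrs.
by rewrite (big_rem r)//= lerDl sumr_ge0// => i _; exact: normc_ge0.
Qed.

Lemma preimages_bounded (W : R) :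
  exists M, forall x, normc f.[x] <= W -> normc x <= M.
Proof.
have [M hM] := roots_bounded fm; exists (M + (`|W| + 1)) => x xW.
have N0 : (0 < N)%N by case: (size f) f1 => [|[]].
have [||r /hM rM xr] := @near_root R f x (`|W| + 1) fm _ f1.
- by rewrite addr_ge0.
- rewrite (le_trans xW)// (le_trans (ler_norm _))//.
  by rewrite (@le_trans _ _ (`|W| + 1)) ?lerDl// ler_eXnr// lerDr.
by have := normcD (x - r) r; rewrite subrK; lra.
Qed.

(** One [s0] serves all lifts of [b], since their modulus of continuity depends only on [f] and
    [normc f.[b]]. *)
Lemma lift_near b : forall e, 0 < e -> exists2 s0, 0 <= s0 < 1 &
  forall g s, is_lift f g -> g 1 = b -> s0 <= s <= 1 -> normc (g s - b) <= e.
Proof.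
move=> e e0; have N0 : (0 < N)%N by case: (size f) f1 => [|[]].
pose d := e / (2 * N%:R); have N0' : 0 < 2 * N%:R :> R by rewrite mulr_gt0 ?ltr0n.
have d0 : 0 < d by rewrite divr_gt0.
have w0 : 0 < normc f.[b] + 1 by rewrite ltr_wpDl// normc_ge0.
pose c := Num.min 1 (d ^+ N / (normc f.[b] + 1)).
have c0 : 0 < c by rewrite lt_min ltr01 divr_gt0// exprn_gt0.
have c1 : c <= 1 by rewrite ge_min lexx.
exists (1 - c) => [|g s [g1 g2] gb /andP[s0 s1]]; first by apply/andP; split; lra.
rewrite -gb (le_trans (g2 s 1 d _ _ (ltW d0) _)) ?lexx ?ler01//.
- by rewrite s1 andbT; lra.
- have cd : c * (normc f.[b] + 1) <= d ^+ N.
    by rewrite -ler_pdivlMr// ge_min lexx orbT.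
  rewrite gb distrC ger0_norm ?subr_ge0//.
  rewrite (le_trans _ cd)// mulrC ler_pM ?normc_ge0 ?subr_ge0 ?lerDl//.
  lra.
- by rewrite mulrCA mulrA mulrC divfK ?gt_eqF.
Qed.

Lemma prod_size_le (rs : seq R[i]) y (H : R) :
  (forall r, r \in rs -> normc (y - r) <= H) ->
  normc (\prod_(r <- rs) ('X - r%:P)).[y] <= H ^+ size rs.
Proof.
move=> h; rewrite horner_prod normc_prod.
have -> : H ^+ size rs = \prod_(r <- rs) H.
  by rewrite big_const_seq count_predT iter_mulr_1.
rewrite big_seq [leRHS]big_seq; apply: ler_prod => r rrs.
by rewrite normc_ge0 hornerXsubC h.
Qed.

(* Otherwise [f - s f(b)] would have [m + 2] roots close to [b], hence be too
   small at a point at distance [t] of [b], where it is about [t^(m + 1)]. *)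
Lemma lift_count b : exists2 s0, 0 <= s0 < 1 &
  forall s (xs : seq R[i]), s0 <= s <= 1 -> uniq xs ->
    (forall x, x \in xs -> exists g, [/\ is_lift f g, g 1 = b & g s = x]) ->
    (size xs <= (mup b f^`()).+1)%N.
Proof.
set w := f.[b].
have f0 : f - w%:P != 0 by rewrite monic_neq0// monic_subC.
have [|G fG Gb] := mup_deriv (b := b) f0; first by rewrite /root !hornerE subrr.
rewrite poly.derivB poly.derivC subr0 in fG; move: (mup _ _) fG => m fG.
set g0 := normc G.[b]; have g00 : 0 < g0 by rewrite normc_gt0.
have [M hM] := preimages_bounded (normc w).
(* [H] bounds the distance from a point within 1 of [b] to any root of [f - s w]; being at least 1,
   it may be raised to the full exponent [N]. *)
pose H := normc b + 1 + `|M| + 1.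
have HE : H = normc b + 1 + `|M| + 1 by [].
have H1 : 1 <= H by rewrite lerDr !addr_ge0 ?normc_ge0.
have H0 : 0 <= H by rewrite (le_trans ler01).
pose K := 2 ^+ m.+2 * H ^+ N; have KE : K = 2 ^+ m.+2 * H ^+ N by [].
have K0 : 0 < K by rewrite mulr_gt0 ?exprn_gt0// (lt_le_trans ltr01).
have g02 : 0 < g0 / 2 by rewrite divr_gt0.
have [d d0 hd] := poly_cts G b g02.
(* [t <= d] keeps [normc G.[y]] above [g0 / 2] at distance [t] of [b]; [t * K <= g0 / 8] bounds
   [f - s w] there by [t ^+ m.+1 * (g0 / 8)], and [c] below makes the shift from [s w] to [w] no
   larger. The contradiction is [1/2 <= 1/8 + 1/8]. *)
pose t := Num.min (Num.min 1 d) (g0 / 8 / K).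
have t0 : 0 < t by rewrite !lt_min ltr01 d0 !divr_gt0.
have t1 : t <= 1 by rewrite !ge_min lexx.
have td : t <= d by rewrite !ge_min lexx orbT.
have tK : t * K <= g0 / 8 by rewrite -ler_pdivlMr// ge_min lexx orbT.
clearbody t.
have [s0 /andP[s00 s01] hs0] := lift_near b t0.
have w0 : 0 < normc w + 1 by rewrite ltr_wpDl// normc_ge0.
have tm : 0 < t ^+ m.+1 by rewrite exprn_gt0.
pose c := g0 / 8 * t ^+ m.+1 / (normc w + 1).
have c0 : 0 < c by rewrite !(divr_gt0, mulr_gt0).
have cE : c * (normc w + 1) = t ^+ m.+1 * (g0 / 8).
  by rewrite /c divfK ?gt_eqF// mulrC.
clearbody c.
exists (Num.max s0 (1 - c)); first by rewrite le_max s00 gt_max s01 ltrBlDr ltrDl.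
move=> s xs0; rewrite ge_max -andbA => /and3P[ss0 sc s1] uxs0 xs0P.
rewrite leqNgt; apply/negP => sxs0.
have s0' : 0 <= s by rewrite (le_trans s00).
pose xs := take m.+2 xs0.
have sxs : size xs = m.+2 by rewrite size_take_min; apply/minn_idPl.
have uxs : uniq xs by rewrite take_uniq.
have xsP x : x \in xs -> f.[x] = s%:C * w /\ normc (x - b) <= t.
  move=> /mem_take/xs0P[g [lg gb <-]]; split; last by apply: hs0; rewrite // ss0.
  by case: lg => + _; rewrite /w -gb; apply; rewrite s0'.
pose p := f - (s%:C * w)%:P.
have pm : p \is monic by exact: monic_subC.
have sp : size p = size f by exact: size_subC.
have rp x : root p x = (f.[x] == s%:C * w) by rewrite /root !hornerE subr_eq0.
have /dvdpP[h ph] : \prod_(x <- xs) ('X - x%:P) %| p.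
  apply: uniq_roots_dvdp; last by rewrite uniq_rootsE.
  by apply/allP => x /xsP[fx _]; rewrite rp fx.
have xm : \prod_(x <- xs) ('X - x%:P) \is monic by rewrite monic_prod_XsubC.
have hm : h \is monic by rewrite -(monicMr _ xm) -ph.
have [rs hrs srs] := monic_split hm.
have [y y01] : exists y, normc (y - b) = t.
  by exists (b + t%:C); rewrite addrC addKr normcR gtr0_norm.
clearbody K H.
have yb : normc y <= normc b + 1.
  by have := normcD (y - b) b; rewrite subrK; lra.
have up : normc p.[y] <= t ^+ m.+1 * (g0 / 8).
  rewrite ph hrs hornerM normcM mulrC.
  have h1 : normc (\prod_(x <- xs) ('X - x%:P)).[y] <= (2 * t) ^+ m.+2.
    rewrite -sxs; apply: prod_size_le => x /xsP[_ xt].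
    by have := normc_triangle b y x; rewrite (normcBC b); lra.
  have h2 : normc (\prod_(r <- rs) ('X - r%:P)).[y] <= H ^+ size rs.
    apply: prod_size_le => r rrs.
    have /eqP fr : f.[r] == s%:C * w.
      by rewrite -rp ph hrs rootM root_prod_XsubC rrs.
    have /hM rM : normc f.[r] <= normc w.
      by rewrite fr normcM normcR ger0_norm// ler_piMl ?normc_ge0.
    have := normcD y (- r); rewrite normcNE; have := ler_norm M.
    by rewrite HE; lra.
  have h3 : H ^+ size rs <= H ^+ N.
    rewrite ler_weXn2l// srs -sp ph size_Mmonic// ?monic_neq0//.
    by rewrite size_prod_XsubC addnS/= -!subn1 leq_sub2r// leq_addr.
  rewrite (le_trans (ler_pM (normc_ge0 _) (normc_ge0 _) h1 (le_trans h2 h3)))//.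
  have -> : (2 * t) ^+ m.+2 * H ^+ N = t ^+ m.+1 * (t * K).
    by rewrite exprMn (exprS t m.+1) KE; move: (_ ^+ _) (t ^+ _) (H ^+ _) => *; ring.
  by rewrite ler_wpM2l// ltW.
have low : normc (f - w%:P).[y] <= normc p.[y] + t ^+ m.+1 * (g0 / 8).
  have -> : (f - w%:P).[y] = p.[y] + (s%:C * w - w).
    by rewrite /p !hornerE /= subrK.
  rewrite (le_trans (normcD _ _))// lerD2l.
  have -> : s%:C * w - w = (s - 1)%:C * w by rewrite rmorphB rmorph1 mulrBl mul1r.
  rewrite normcM normcR distrC ger0_norm ?subr_ge0//.
  rewrite (@le_trans _ _ (c * (normc w + 1)))//.
    by apply: ler_pM; rewrite ?normc_ge0 ?subr_ge0 ?lerDl//; lra.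
  by rewrite cE.
have Gy : g0 / 2 <= normc G.[y].
  have := hd y; rewrite y01 => /(_ td).
  by have := normc_triangle G.[y] G.[b] 0; rewrite !subr0 (normcBC G.[b]) -/g0; lra.
have : t ^+ m.+1 * (g0 / 2) <= normc (f - w%:P).[y].
  rewrite fG hornerM horner_exp hornerXsubC normcM normcX y01 mulrC.
  by rewrite ler_wpM2r// ltW.
have : 0 < t ^+ m.+1 * g0 by rewrite mulr_gt0.
lra.
Qed.

End LocalCount.

(** * Trees *)

Lemma uniq_map_inj (T1 T2 : eqType) (h : T1 -> T2) (s : seq T1) :
  uniq (map h s) -> {in s &, injective h}.
Proof.
elim: s => [//|a s IH] /= /andP[has us] x y; rewrite !inE.
move=> /orP[/eqP->|xs] /orP[/eqP->|ys] // hxy; last exact: IH.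
- by move: has; rewrite hxy map_f.
- by move: has; rewrite -hxy map_f.
Qed.

Section SpanningTrees.
Variable T : choiceType.
Implicit Types (E : seq (T * T)) (V : seq T) (x y z : T).

Definition conn (e : rel T) x y := exists2 p, path e x p & last x p = y.

Lemma conn_refl (e : rel T) x : conn e x x.
Proof. by exists [::]. Qed.

Lemma conn_trans (e : rel T) y x z : conn e x y -> conn e y z -> conn e x z.
Proof.
move=> [p ep <-] [q eq <-]; exists (p ++ q); last by rewrite last_cat.
by rewrite cat_path ep.
Qed.

Lemma conn1 (e : rel T) x y : e x y -> conn e x y.
Proof. by move=> exy; exists [:: y] => //=; rewrite exy. Qed.

Lemma conn_sub (e : rel T) (P : T -> T -> Prop) :
  (forall x, P x x) -> (forall x y z, P x y -> P y z -> P x z) ->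
  (forall x y, e x y -> P x y) -> forall x y, conn e x y -> P x y.
Proof.
move=> Pr Pt eP x y [p + <-]; elim: p x => [//|z p IH] x /= /andP[exz pz].
exact: Pt (eP _ _ exz) (IH _ pz).
Qed.

Lemma conn_mono (e e' : rel T) x y : (forall x y, e x y -> conn e' x y) ->
  conn e x y -> conn e' x y.
Proof.
move=> ee'; apply: (@conn_sub e ) => //.
  exact: conn_refl.
by move=> ? ? ?; exact: conn_trans.
Qed.

Lemma conn_sym (e : rel T) x y : symmetric e -> conn e x y -> conn e y x.
Proof.
move=> es; apply: (@conn_sub e (fun x y => conn e y x)).
- exact: conn_refl.
- by move=> a b c ab bc; exact: conn_trans bc ab.
- by move=> a b; rewrite es; exact: conn1.
Qed.

Definition adj E : rel T := fun x y => ((x, y) \in E) || ((y, x) \in E).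

Lemma adj_sym E : symmetric (adj E).
Proof. by move=> x y; rewrite /adj orbC. Qed.

(* Contracting the first edge of [E] removes at most one vertex. *)
Lemma conn_size E V : uniq V ->
  (forall x y, x \in V -> y \in V -> conn (adj E) x y) ->
  (size V <= (size E).+1)%N.
Proof.
move sn : (size E) => n.
elim: n E sn V => [|n IH] [|[a b] E] //= sn V uV cV.
  case: V uV cV => [//|x [//|y V]] /= /andP[+ _] /(_ x y).
  rewrite !inE eqxx eqxx orbT => /negP xy /(_ isT isT)[[|z p] /= ].
    by move=> _ yx; case: xy; rewrite yx eqxx.
  by [].
pose phi x := if x == b then a else x.
have hV : (size V <= (size (rem b V)).+1)%N.
  have [bV|bV] := boolP (b \in V); first by rewrite size_rem// leqSpred.
  by rewrite rem_id.
rewrite (leq_trans hV)// ltnS.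
apply: (IH [seq (phi p.1, phi p.2) | p <- E]) => [||x y].
- by rewrite size_map; case: sn.
- exact: rem_uniq.
rewrite !mem_rem_uniq// !inE => /andP[xb xV] /andP[yb yV].
have -> : x = phi x by rewrite /phi (negbTE xb).
have -> : y = phi y by rewrite /phi (negbTE yb).
apply: (@conn_sub (adj ((a, b) :: E)) 
  (fun x y => conn (adj _) (phi x) (phi y))).
- by move=> z; exact: conn_refl.
- by move=> u v w; exact: conn_trans.
- move=> u v; rewrite /adj !inE => /orP[]/orP[/eqP[-> ->]|h].
  + by rewrite /phi eqxx; case: eqP => _; exact: conn_refl.
  + by apply: conn1; rewrite /adj (map_f (fun p => (phi p.1, phi p.2)) h).
  + by rewrite /phi eqxx; case: eqP => _; exact: conn_refl.
  + apply: conn1; rewrite /adj.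
    by rewrite (map_f (fun p => (phi p.1, phi p.2)) h) orbT.
- exact: cV.
Qed.

Section Minimal.
Variables (E : seq (T * T)) (V : seq T).
Hypotheses (uV : uniq V) (EV : (size E < size V)%N).
Hypothesis cV : forall x y, x \in V -> y \in V -> conn (adj E) x y.

(** Otherwise dropping [p] would leave [V] connected by too few pairs. This excludes loops, repeated
    edges and cycles at once. *)
Lemma minimal_conn E1 p E2 : E = E1 ++ p :: E2 ->
  ~ conn (adj (E1 ++ E2)) p.1 p.2.
Proof.
move=> EE cp; have : (size V <= (size (E1 ++ E2)).+1)%N.
  apply: conn_size => // x y xV yV.
  apply: conn_mono (cV xV yV) => a b; rewrite EE /adj !mem_cat !inE.
  case ab1 : ((a, b) \in E1); first by move=> _; apply: conn1; rewrite /adj mem_cat ab1.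
  case ab2 : ((a, b) \in E2); first by move=> _; apply: conn1; rewrite /adj mem_cat ab2 orbT.
  case ba1 : ((b, a) \in E1); first by move=> _; apply: conn1; rewrite /adj !mem_cat ba1 ?orbT.
  case ba2 : ((b, a) \in E2); first by move=> _; apply: conn1; rewrite /adj !mem_cat ba2 ?orbT.
  rewrite !orbF /= => /orP[]/eqP pab; move: cp; rewrite -pab => //.
  exact: (conn_sym (@adj_sym _)).
by move: EV; rewrite EE !size_cat/=; lia.
Qed.

End Minimal.

Definition edge_of (p : T * T) : {fset T} := [fset p.1; p.2]%fset.

Lemma edge_ofE x y p : (edge_of p == [fset x; y]%fset) =
  ((x, y) == p) || ((y, x) == p).
Proof.
case: p => a b; rewrite /edge_of/=; apply/eqP/orP => [h|[/eqP[-> ->]//|/eqP[-> ->]]].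
- have : x \in [fset a; b] by rewrite h !inE eqxx.
  have : y \in [fset a; b] by rewrite h !inE eqxx orbT.
  have : a \in [fset x; y] by rewrite -h !inE eqxx.
  have : b \in [fset x; y] by rewrite -h !inE eqxx orbT.
  rewrite !inE !xpair_eqE => /orP[]/eqP-> /orP[]/eqP-> /orP[]/eqP ? /orP[]/eqP ?;
    subst; rewrite !eqxx; by [left|right].
- by rewrite fsetUC.
Qed.

(** The pairs in [L b] become edges labelled by [b]. Connectivity with so few pairs forbids
    bypassing any of them; hence the label of an edge is well defined, even across different lists,
    and elementary chains are unique. *)
Lemma tree_of_lists (A B : {fset T}) (L : T -> seq (T * T)) :
  A != fset0 ->
  (forall b p, b \in B -> p \in L b -> p.1 \in A /\ p.2 \in A) ->
  (forall x y, x \in A -> y \in A ->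
     conn (fun u v => has (fun b => adj (L b) u v) B) x y) ->
  (\sum_(b <- B) size (L b) <= #|` A| - 1)%N ->
  (\sum_(b <- B) size (L b) = #|` A| - 1)%N /\
  exists (G : graph T) (label : edges G -> B),
    [/\ is_tree G, vertices G = A, #|` edges G| = (#|` A| - 1)%N,
        forall b : B, #|[pred e | label e == b]| = size (L (val b)) &
        forall e : edges G,
          exists2 p, p \in L (val (label e)) & val e = [fset p.1; p.2]%fset].
Proof.
move=> A0 LA cA sA.
pose E : seq (T * (T * T)) := [seq (b, p) | b <- enum_fset B, p <- L b].
pose E2 := [seq q.2 | q <- E].
have EP q : (q \in E) = (q.1 \in B) && (q.2 \in L q.1).
  apply/allpairsPdep/andP => [[b [p [bB pL ->]]]//|[qB qL]].
  by exists q.1, q.2; split=> //; case: (q).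
have sE : size E = (\sum_(b <- B) size (L b))%N.
  by rewrite size_allpairs_dep sumnE big_map.
have E2P p : reflect (exists2 b, b \in B & p \in L b) (p \in E2).
  apply: (iffP mapP) => [[q + ->]|[b bB pL]].
    by rewrite EP => /andP[? ?]; exists q.1.
  by exists (b, p) => //; rewrite EP bB.
have A1 : (0 < #|` A|)%N by rewrite cardfs_gt0.
have cE x y : x \in enum_fset A -> y \in enum_fset A -> conn (adj E2) x y.
  move=> xA yA; apply: conn_mono (cA x y xA yA) => {x y xA yA} x y.
  move=> /hasP[b bB]; rewrite /adj => h; apply: conn1; apply/orP.
  by case/orP: h => h; [left|right]; apply/E2P; exists b.
have uA : uniq (enum_fset A) by exact: fset_uniq.
have sE2 : size E2 = (#|` A| - 1)%N.
  apply/eqP; rewrite eqn_leq size_map sE sA -sE leq_subLR add1n.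
  by have := conn_size uA cE; rewrite size_map.
split; first by rewrite -sE2 size_map sE.
have EV : (size E2 < size (enum_fset A))%N by rewrite sE2 subn1 prednK.
have minE := minimal_conn uA EV cE.
(* Of two pairs giving the same edge, one would bypass the other. *)
have uE : uniq [seq edge_of q.2 | q <- E].
  have : forall E1 E', E2 = E1 ++ E' -> uniq [seq edge_of p | p <- E'].
    move=> E1 E'; elim: E' E1 => [//|p E' IH] E1 EE /=.
    rewrite (IH (rcons E1 p)) ?cat_rcons// andbT; apply/mapP => -[q qE'].
    move=> /esym/eqP; rewrite [edge_of p]/edge_of edge_ofE => h.
    apply: (minE _ _ _ EE); apply: conn1; rewrite /adj !mem_cat.
    by case/orP: h => /eqP; rewrite /= => ->; rewrite qE' ?orbT.
  by move=> /(_ [::] E2 erefl); rewrite /E2 -map_comp.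
pose ES := seq_fset tt [seq edge_of q.2 | q <- E].
have ESP (e : {fset T}) : reflect (exists2 q, q \in E & e = edge_of q.2) (e \in ES).
  by rewrite seq_fsetE; apply: mapP.
have Eq q q' : q \in E -> q' \in E -> edge_of q.2 = edge_of q'.2 -> q = q'.
  by move=> qE q'E h; exact: (uniq_map_inj uE).
have pneq p : p \in E2 -> p.1 != p.2.
  move=> pE; apply/eqP => pp; case/splitPr: pE minE => E1 E3 minE.
  by apply: (minE E1 p E3 erefl); rewrite pp; exact: conn_refl.
have ESA (e : {fset T}) : e \in ES -> (e `<=` A)%fset.
  move=> /ESP[q]; rewrite EP => /andP[qB qL] ->.
  have [h1 h2] := LA _ _ qB qL.
  by apply/fsubsetP => x; rewrite !inE => /orP[]/eqP->.
have ES2 (e : {fset T}) : e \in ES -> #|` e| = 2%N.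
  move=> /ESP[q qE ->]; rewrite cardfs2.
  by rewrite pneq// /E2 map_f.
pose G := Graph ESA ES2.
have adjG x y : Defs.adjacent G x y = adj E2 x y.
  rewrite /Defs.adjacent /adj /=; apply/ESP/orP => [[q qE /esym/eqP]|h].
    by rewrite edge_ofE => /orP[]/eqP ->; [left|right]; exact: map_f.
  by case: h => /mapP[q qE hq]; exists q => //; rewrite -hq /edge_of//= fsetUC.
have adjA x y : adj E2 x y -> (x \in A) && (y \in A).
  by move=> /orP[]/E2P[b bB /(LA _ _ bB)[/= -> ->]].
have /choice[F hF] : forall e : edges G, exists q : B * (T * T),
    (val q.1, q.2) \in E /\ edge_of q.2 = val e.
  move=> [e eG]; have /ESP[[b p] qE ep] := eG.
  have bB : b \in B by move: qE; rewrite EP => /andP[].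
  by exists ([` bB]%fset, p).
exists G, (fun e => (F e).1); split => //.
- move=> x y xA yA xy.
  have [p pp lp] := cE x y xA yA.
  have {}pp : path (Defs.adjacent G) x p by rewrite (eq_path adjG).
  move: lp; case/shortenP: pp => {}p pp up _ lp.
  exists p; split.
    split=> // z; rewrite inE => /orP[/eqP->//|zp].
    move: pp zp {up lp}; elim: p x {xA xy} => // a p IH x /= /andP[xa ap].
    rewrite inE => /orP[/eqP->|]; last exact: IH ap.
    by move: xa; rewrite adjG => /adjA/andP[].
  (* Two chains are followed until they first differ, going from [x] to [a] and to [b]. What remains
     of both avoids [x], so it bypasses the edge between [x] and [a] through [b] and the common
     end. *)
  move=> q [_ uq qq lq]; move: lq lp uq up qq pp => {xA yA xy}.
  elim: p q x => [|a p IH] [|b q] x //=.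
  + by move=> lq xy; rewrite -xy in lq; rewrite -lq mem_last.
  + by move=> xy lq _; rewrite -xy in lq; rewrite -lq mem_last.
  move=> lq lp /andP[xq uq] /andP[xp up] /andP[xb qq] /andP[xa pp].
  have [ab|ab] := eqVneq a b; first by rewrite ab in up pp lp *; rewrite (IH q b).
  have [r rE hr] : exists2 r, r \in E2 & (x, a) == r \/ (a, x) == r.
    by move: xa; rewrite adjG => /orP[] h; [exists (x, a)|exists (a, x)]; auto.
  case/splitPr: rE minE adjG => E1 E3 minE adjG; exfalso.
  have step u v : Defs.adjacent G u v -> (u, v) != (x, a) -> (u, v) != (a, x) ->
      adj (E1 ++ E3) u v.
    rewrite adjG /adj !mem_cat !inE => + h1 h2.
    have -> : ((u, v) == r) = false by case: hr => /eqP <-; apply/negbTE.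
    have -> : ((v, u) == r) = false.
      by case: hr => /eqP <-; rewrite xpair_eqE andbC -xpair_eqE; apply/negbTE.
    by [].
  have paths u s : x \notin u :: s -> path (Defs.adjacent G) u s ->
      conn (adj (E1 ++ E3)) u (last u s).
    elim: s u => [|v s IHs] u; first by move=> *; exact: conn_refl.
    rewrite inE negb_or => /andP[xu xs] /= /andP[uv vs].
    apply: conn_trans (IHs _ xs vs); apply: conn1; apply: step => //.
      by rewrite xpair_eqE eq_sym negb_and xu.
    move: xs; rewrite inE negb_or => /andP[xv _].
    by rewrite xpair_eqE negb_and orbC eq_sym xv.
  have cxa : conn (adj (E1 ++ E3)) x a.
    apply: (@conn_trans _ b).
      apply: conn1; apply: step => //; first by rewrite xpair_eqE eqxx eq_sym.
      rewrite xpair_eqE negb_and; apply/orP; right; rewrite eq_sym.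
      by move: xq; rewrite inE negb_or => /andP[].
    apply: (conn_trans (paths _ _ xq qq)); rewrite lq -lp.
    exact/(conn_sym (@adj_sym _))/paths.
  apply: (minE E1 r E3 erefl); case: hr => /eqP <- //.
  exact: (conn_sym (@adj_sym _)).
- rewrite -sE2 [LHS](size_seq_fset tt [seq edge_of q.2 | q <- E]).
  by rewrite undup_id// !size_map.
(* Sending an edge to its oriented pair is a bijection from the edges labelled [b] onto [L b]. *)
- move=> b; rewrite cardE -(size_map (fun e => (F e).2)); apply: perm_size.
  apply: uniq_perm.
  + rewrite map_inj_in_uniq ?enum_uniq// => e e' _ _ h.
    by apply: val_inj; rewrite -(hF e).2 -(hF e').2 h.
  + have : uniq [seq (val b, p) | p <- L (val b)].
      have := map_uniq uE; rewrite /E; have : val b \in enum_fset B := valP b.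
      elim: (enum_fset B) => // c s IHs; rewrite in_cons allpairs_cons cat_uniq.
      move=> /orP[/eqP bc /and3P[us _ _]|bs /and3P[_ _ us]]; last exact: IHs.
      by rewrite bc.
    by move=> /map_uniq.
  + move=> p; apply/mapP/idP => [[e]|pL].
      rewrite mem_enum inE => /eqP <- ->; have [+ _] := hF e.
      by rewrite EP => /andP[].
    have qE : (val b, p) \in E by rewrite EP/= pL (valP b).
    have eG : edge_of p \in edges G by apply/ESP; exists (val b, p).
    have [h1 h2] := hF [` eG]%fset; have := Eq _ _ h1 qE h2 => -[hb hp].
    exists [` eG]%fset; last by rewrite hp.
    by rewrite mem_enum inE; apply/eqP/val_inj.
- move=> e; have [h1 h2] := hF e; exists (F e).2; last by rewrite -h2.
  by move: h1; rewrite EP => /andP[].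
Qed.

End SpanningTrees.

(** * Counting critical points *)

Section CriticalCount.
Variable R : realType.
Implicit Types (p f : {poly R[i]}) (z : R[i]).

Lemma mup_split p c rs z : c != 0 -> p = c *: \prod_(r <- rs) ('X - r%:P) ->
  mup z p = count_mem z rs.
Proof.
move=> c0 ->; rewrite -mul_polyC mupMr ?mu_prod_XsubC//.
by rewrite rootC.
Qed.

Lemma sum_count_mem (T : eqType) (s rs : seq T) : uniq s ->
  (\sum_(z <- s) count_mem z rs = count [in s] rs)%N.
Proof.
elim: rs => [|r rs IH] us; first by rewrite big1.
rewrite /= -IH// big_split /=; congr addn.
have [rs'|rs'] := boolP (r \in s).
  rewrite (big_rem r)//= eqxx big_seq big1 ?addn0// => z.
  by rewrite mem_rem_uniq// !inE eq_sym => /andP[/negbTE ->].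
rewrite big_seq big1// => z zs; apply/eqP; rewrite eqb0.
by apply: contra rs' => /eqP ->.
Qed.

Lemma size_deriv_monic f : f \is monic -> (1 < size f)%N ->
  size f^`() = (size f).-1.
Proof.
move=> fm f1.
have f2 : (size f).-2.+1 = (size f).-1 by case: (size f) f1 => [|[]].
rewrite /deriv size_poly_eq//= f2 -[_`_ _]/(lead_coef f) (monicP fm).
by rewrite pnatr_eq0; case: (size f) f1 => [|[]].
Qed.

Lemma deriv_monic_neq0 f : f \is monic -> (1 < size f)%N -> f^`() != 0.
Proof.
move=> fm f1; rewrite -size_poly_gt0 size_deriv_monic//.
by case: (size f) f1 => [|[]].
Qed.

(** With multiplicity, [f] has [n] roots and its derivative [n - 1], where [n] is the degree. At
    each root of [f] the order drops by one, so [A] accounts for [n - s] zeros of the derivative,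
    where [s] is the size of [A], and [s - 1] are left for [B]. *)
Lemma sum_mup_critical f (A B : {fset R[i]}) : f \is monic -> (1 < size f)%N ->
  (forall z, (z \in A) = root f z) ->
  (forall z, (z \in B) = root f^`() z && ~~ root f z) ->
  (\sum_(z <- B) mup z f^`() = #|` A| - 1)%N.
Proof.
move=> fm f1 hA hB; have f0 := monic_neq0 fm.
have sf' := size_deriv_monic fm f1.
have f'0 := deriv_monic_neq0 fm f1.
have [rs fE] := closed_field_poly_normal f.
have [rs' f'E] := closed_field_poly_normal f^`().
have c0 : lead_coef f != 0 by rewrite lead_coef_eq0.
have c'0 : lead_coef f^`() != 0 by rewrite lead_coef_eq0.
have srs : size rs = (size f).-1.
  by have := congr1 (fun p : {poly R[i]} => size p) fE; rewrite size_scale// size_prod_XsubC => ->.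
have srs' : size rs' = (size f).-2.
  by have := congr1 (fun p : {poly R[i]} => size p) f'E;
     rewrite size_scale// size_prod_XsubC sf' => ->.
have rs'0 z : (z \in rs') = root f^`() z.
  by rewrite [f^`()]f'E rootZ// root_prod_XsubC.
have rs0 z : (z \in rs) = root f z by rewrite fE rootZ// root_prod_XsubC.
have uA : uniq (enum_fset A) := fset_uniq A.
have uB : uniq (enum_fset B) := fset_uniq B.
have sumA : (\sum_(z <- A) mup z f = (size f).-1)%N.
  under eq_bigr do rewrite (mup_split _ c0 fE).
  rewrite sum_count_mem// -srs; apply/eqP; rewrite -all_count.
  by apply/allP => z; rewrite rs0 -hA.
have sumAB : (\sum_(z <- A) mup z f^`() + \sum_(z <- B) mup z f^`() = (size f).-2)%N.
  rewrite -srs'.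
  under eq_bigr do rewrite (mup_split _ c'0 f'E).
  under [X in (_ + X)%N]eq_bigr do rewrite (mup_split _ c'0 f'E).
  rewrite !sum_count_mem// -count_predUI.
  rewrite [X in (_ + X)%N](_ : _ = 0%N) ?addn0.
    apply/eqP; rewrite -all_count; apply/allP => z /=; rewrite rs'0 => rz.
    by rewrite (hA z) (hB z) rz/=; case: root.
  apply/eqP; rewrite -leqn0 leqNgt -has_count; apply/hasPn => z _ /=.
  by rewrite (hA z) (hB z); case: (root f z); rewrite ?andbF.
have sumA' : (\sum_(z <- A) mup z f^`() + #|` A| = (size f).-1)%N.
  rewrite -sumA -(sum1_size (enum_fset A)) -big_split /= big_seq [RHS]big_seq.
  apply: eq_bigr => z; rewrite hA => rz.
  have [q fq qz] := mup_deriv f0 rz; rewrite [in RHS]fq mupMr//.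
  by rewrite mup_XsubCX eqxx addn1.
have : (0 < #|` A|)%N.
  have /closed_rootP[z rz] : size f != 1%N by case: (size f) f1 => [|[]].
  by rewrite cardfs_gt0; apply/fset0Pn; exists z; rewrite hA.
lia.
Qed.

End CriticalCount.

(** * Flat reparametrizations *)

Section FlatReparametrization.
Variable R : realType.
Implicit Types (P q : {poly R}) (x y c d s : R).

Lemma odd_exprn_lt n x y : odd n -> x < y -> x ^+ n < y ^+ n.
Proof.
move=> on xy; have n0 : n != 0%N by case: n on.
have [x0|x0] := leP 0 x; first by rewrite ltrXn2r// (le_trans x0)// ltW.
have [y0|y0] := leP 0 y; last first.
  have oddN z : (- z) ^+ n = - z ^+ n by rewrite exprNn -signr_odd on mulN1r.
  rewrite -ltrN2 -!oddN ltrXn2r ?nnegrE ?oppr_ge0 ?ltrN2// ?(ltW y0)//.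
by rewrite (@lt_le_trans _ _ 0) ?exprn_ge0// exprn_odd_lt0.
Qed.

Lemma real_poly_bounded q :
  exists2 B, 0 <= B & forall y, 0 <= y <= 1 -> `|q.[y]| <= B.
Proof.
have [B B0 hB] := poly_bounded (map_poly (real_complex R) q) 1.
exists B => // y /andP[y0 y1]; have := hB y%:C.
by rewrite horner_map !normcR ger0_norm// => ->.
Qed.

(** These are the parameters of the map [k * ((x - d) ^+ n + d ^+ n)], which fixes 0 and 1,
    increases, and is flat to order [n] at [d], where its value is [s]. The equation for [d] is
    solved by the intermediate value theorem. *)
Lemma smooth_step n s : odd n -> 0 <= s <= 1 -> exists d k, [/\ 0 <= d <= 1,
  0 < k, k * d ^+ n = s & k * ((1 - d) ^+ n + d ^+ n) = 1].
Proof.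
move=> on /andP[s0 s1]; have n0 : (n > 0)%N by case: n on.
pose q : {poly R} := 'X^n - s *: ('X^n + (1 - 'X) ^+ n).
have qE x : q.[x] = x ^+ n - s * (x ^+ n + (1 - x) ^+ n) by rewrite !hornerE.
have [|d dI /eqP] := @poly_ivt R q 0 1 ler01.
- by rewrite !qE expr0n subr0 subrr expr1n expr0n gtn_eqF//= addr0 add0r; lra.
rewrite qE => /eqP; rewrite subr_eq0 => /eqP dE; exists d.
move: dI => /andP[d0 d1].
have D0 : 0 < (1 - d) ^+ n + d ^+ n.
  have [->|d0'] := eqVneq d 0; first by rewrite subr0 expr1n expr0n gtn_eqF// addr0.
  by rewrite ltr_wpDl ?exprn_ge0 ?subr_ge0// exprn_gt0// lt_def d0'.
exists ((1 - d) ^+ n + d ^+ n)^-1; split; rewrite ?d0 ?invr_gt0 ?mulVf ?gt_eqF//.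
by rewrite [X in _ * X]dE (addrC (d ^+ n)) mulrCA mulVf ?gt_eqF// mulr1.
Qed.

(** By induction on [S]: a new value [c], taken by [P] at [s], is treated by composing with a map
    [h] that is flat where it equals [s]. Flatness obtained before survives, as [h - h(x)] is
    divisible by ['X - x]. With [n] odd, [h] increases through its flat point. *)
Lemma flat_reparam n (S : seq R) : odd n -> exists P, [/\ P.[0] = 0, P.[1] = 1,
  forall x y, 0 <= x -> x < y -> y <= 1 -> P.[x] < P.[y] &
  forall x, 0 <= x <= 1 -> P.[x] \in S ->
    exists q, P - P.[x]%:P = q * ('X - x%:P) ^+ n].
Proof.
move=> on; elim: S => [|c S [P [P0 P1 Pinc Pflat]]].
  by exists 'X; split=> [||x y _ xy _|//]; rewrite !hornerX.
have Ple x y : 0 <= x -> x <= y -> y <= 1 -> P.[x] <= P.[y].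
  by move=> x0; rewrite le_eqVlt => /predU1P[->//|xy] y1; exact/ltW/Pinc.
have PI x : 0 <= x <= 1 -> 0 <= P.[x] <= 1.
  by move=> /andP[x0 x1]; rewrite -P0 -[X in _ <= _ <= X]P1 !Ple.
have [cI|cI] := boolP (0 <= c <= 1); last first.
  exists P; split=> // x xI; rewrite inE => /predU1P[Pc|]; last exact: Pflat.
  by move: cI; rewrite -Pc PI.
have [|s sI /eqP] := @poly_ivt R (P - c%:P) 0 1 ler01.
  by rewrite !hornerE P0 P1; case/andP: cI => ? ?; lra.
rewrite !hornerE => /eqP; rewrite subr_eq0 => /eqP Ps.
have [d [k [dI k0 kd k1]]] := smooth_step on sI.
pose h : {poly R} := k *: (('X - d%:P) ^+ n + (d ^+ n)%:P).
have hE x : h.[x] = k * ((x - d) ^+ n + d ^+ n).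
  by rewrite /h !hornerE.
have h0 : h.[0] = 0.
  by rewrite hE sub0r exprNn -signr_odd on expr1 mulN1r addNr mulr0.
have h1 : h.[1] = 1 by rewrite hE.
have hinc x y : x < y -> h.[x] < h.[y].
  by move=> xy; rewrite !hE ltr_pM2l// ltrD2r odd_exprn_lt// ltrD2r.
have hle x y : x <= y -> h.[x] <= h.[y].
  by rewrite le_eqVlt => /predU1P[->//|/hinc/ltW].
have hI x : 0 <= x <= 1 -> 0 <= h.[x] <= 1.
  by move=> /andP[x0 x1]; rewrite -h0 -[X in _ <= _ <= X]h1 !hle.
have hd : h.[d] = s.
  by rewrite hE subrr expr0n gtn_eqF//= ?add0r ?kd//; case: (n) on.
exists (P \Po h); split.
- by rewrite horner_comp h0.
- by rewrite horner_comp h1.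
- move=> x y x0 xy y1; rewrite !horner_comp; apply: Pinc; last 2 first.
  + exact: hinc.
  + by rewrite -h1 hle.
  + by rewrite -h0 hle.
move=> x xI; rewrite horner_comp inE => /predU1P[Phx|/Pflat].
  have hxs : h.[x] = s.
    have /andP[a0 a1] := hI x xI; have /andP[s0 s1] := sI.
    apply/eqP; rewrite eq_le !leNgt; apply/andP; split; apply/negP => hs.
      by have := Pinc _ _ s0 hs a1; rewrite Phx Ps ltxx.
    by have := Pinc _ _ a0 hs s1; rewrite Phx Ps ltxx.
  have xd : x = d.
    apply/eqP; rewrite eq_le !leNgt; apply/andP; split; apply/negP => /hinc;
    by rewrite hd hxs ltxx.
  have /factor_theorem[q qE] : root (P - c%:P) s.
    by rewrite /root !hornerE Ps subrr.
  have -> : P \Po h - (P.[h.[x]])%:P = (P - c%:P) \Po h.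
    by rewrite comp_polyB comp_polyC Phx.
  rewrite qE comp_polyM comp_polyB comp_polyX comp_polyC.
  have -> : h - s%:P = k *: ('X - d%:P) ^+ n.
    by rewrite /h scalerDr -(mul_polyC k (d ^+ n)%:P) -polyCM kd addrK.
  by exists (k *: (q \Po h)); rewrite xd -scalerAr -scalerAl.
move=> /(_ (hI x xI))[q qE].
have -> : P \Po h - (P.[h.[x]])%:P = (P - P.[h.[x]]%:P) \Po h.
  by rewrite comp_polyB comp_polyC.
have /factor_theorem[r rE] : root (h - h.[x]%:P) x.
  by rewrite /root !hornerE subrr.
exists ((q \Po h) * r ^+ n); rewrite qE comp_polyM rmorphXn/=.
by rewrite comp_polyB comp_polyX comp_polyC rE exprMn mulrA.
Qed.

End FlatReparametrization.

(** * Variation of functions with few preimages *)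

Section Variation.
Variable R : realType.
Implicit Types (a b : nat -> R) (lo hi x y t : R) (m n : nat).
Local Notation mu := (@lebesgue_measure R).

(** The number of intervals containing [y] is integrated over [[lo, hi]]: interval by interval this
    gives the sum of the lengths, while pointwise it is at most [n]. *)
Lemma overlap_bound m n a b lo hi : lo <= hi ->
  (forall i, (i < m)%N -> [/\ lo <= a i, a i <= b i & b i <= hi]) ->
  (forall y, (count (fun i => a i < y < b i)%R (iota 0 m) <= n)%N) ->
  \sum_(0 <= i < m) (b i - a i) <= n%:R * (hi - lo).
Proof.
move=> lohi ab cnt.
pose F i y : \bar R := (\1_(`]a i, b i[%classic : set R) y)%:E.
have mF i : measurable_fun setT (F i).
  by apply/measurable_EFinP; exact: measurable_indic.
have F0 i y : (0 <= F i y)%E by rewrite lee_fin indicE ler0n.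
have h1 : (\int[mu]_(y in `[lo, hi]) (\sum_(0 <= i < m) F i y) =
    \sum_(0 <= i < m) \int[mu]_(y in `[lo, hi]) F i y)%E.
  by rewrite ge0_integral_sum// => i; exact: measurable_funS (mF i).
have h2 i : (i < m)%N ->
    (\int[mu]_(y in `[lo, hi]) F i y)%E = (b i - a i)%:E.
  move=> im; have [h3 h4 h5] := ab i im.
  rewrite integral_indic// setIidl; last first.
    move=> y /=; rewrite !in_itv/= => /andP[ay yb].
    by rewrite (le_trans h3 (ltW ay)) (le_trans (ltW yb) h5).
  rewrite [LHS]lebesgue_measure_itv/= lte_fin -EFinD; case: ltP => // ba.
  by congr EFin; apply/eqP; rewrite eq_sym subr_eq0 eq_le h4 ba.
have h6 y : (\sum_(0 <= i < m) F i y)%E =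
    (count (fun i => a i < y < b i)%R (iota 0 m))%:R%:E :> \bar R.
  rewrite /index_iota subn0; elim: (iota 0 m) => [|i s IH].
    by rewrite big_nil.
  rewrite big_cons IH /= /F -EFinD natrD indicE; congr (EFin (_%:R + _)).
  by congr (nat_of_bool _); apply/idP/idP; rewrite inE /= in_itv/=.
rewrite -lee_fin -sumEFin.
have -> : (\sum_(0 <= i < m) (b i - a i)%:E =
    \int[mu]_(y in `[lo, hi]) (\sum_(0 <= i < m) F i y))%E.
  by rewrite h1; apply: eq_big_nat => i /andP[_ im]; rewrite h2.
rewrite (@le_trans _ _ (\int[mu]_(y in `[lo, hi]) n%:R%:E)%E)//.
  apply: ge0_le_integral => //.
  - by move=> y _; apply: sume_ge0.
  - by apply: emeasurable_sum => i; exact: measurable_funS (mF i).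
  - by move=> y _; rewrite h6 lee_fin ler_nat.
rewrite integral_cst//= [X in (_ * X)%E]lebesgue_measure_itv/= lte_fin -EFinD.
case: ltP => hl; first by rewrite -EFinM.
by rewrite mule0 lee_fin mulr_ge0// subr_ge0.
Qed.

Lemma within_continuous_eps (h : R -> R) (A : set R) :
  (forall x e, A x -> 0 < e -> exists2 d, 0 < d &
     forall y, A y -> `|y - x| <= d -> `|h y - h x| <= e) ->
  {within A, continuous h}.
Proof.
move=> H; apply/subspace_continuousP => x Ax; apply/cvgrPdist_le => e e0.
have [d d0 hd] := H x e Ax e0; rewrite near_withinE.
apply: filterS (nbhsx_ballx x d d0) => y xy Ay.
by rewrite distrC; apply: hd => //; rewrite distrC; exact: ltW.
Qed.

Lemma itv_partition_lt (s : seq R) x y i : itv_partition x y s ->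
  (i < size s)%N -> nth y (x :: s) i < nth y s i.
Proof. by move=> [/(pathP y) + _] => /[apply]. Qed.

Lemma itv_partition_nth_mono (s : seq R) x y i j : itv_partition x y s ->
  (i <= j <= size s)%N -> nth y (x :: s) i <= nth y (x :: s) j.
Proof.
move=> P /andP[ij js]; elim: j ij js => [|j IH].
  by rewrite leqn0 => /eqP ->.
rewrite leq_eqVlt => /predU1P[->//|]; rewrite ltnS => ij js.
rewrite (le_trans (IH ij (ltnW js)))//=.
exact/ltW/(itv_partition_lt P).
Qed.

(* By the intermediate value theorem, a value lying strictly between those at the
   ends of some steps of the partition is taken inside each of these steps. *)
Lemma variation_bound n (h : R -> R) lo hi (s : seq R) :
  {within `[0, 1], continuous h} -> lo <= hi ->
  (forall t, 0 <= t <= 1 -> lo <= h t <= hi) ->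
  (forall y (ts : seq R), uniq ts ->
     (forall t, t \in ts -> 0 <= t <= 1 /\ h t = y) -> (size ts <= n)%N) ->
  itv_partition 0 1 s ->
  \sum_(0 <= i < size s) `|h (nth 1 s i) - h (nth 1 (0 :: s) i)|
    <= n%:R * (hi - lo).
Proof.
move=> ch lohi hI hn P; pose p i := nth 1 (0 :: s) i.
have p01 i : (i <= size s)%N -> 0 <= p i <= 1.
  move=> im; have ps : p (size s) = 1 by rewrite /p (itv_partition_nth_size 1 P).
  apply/andP; split.
    by rewrite -[leLHS]/(p 0%N) (itv_partition_nth_mono P).
  by rewrite -[leRHS]ps (itv_partition_nth_mono P)// im leqnn.
pose a i := Num.min (h (p i)) (h (p i.+1)).
pose b i := Num.max (h (p i)) (h (p i.+1)).
have -> : \sum_(0 <= i < size s) `|h (nth 1 s i) - h (nth 1 (0 :: s) i)| =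
    \sum_(0 <= i < size s) (b i - a i).
  apply: eq_bigr => i _; rewrite /a /b -/(p i) -[nth 1 s i]/(p i.+1).
  by case: (leP (h (p i)) (h (p i.+1))) => hh;
    [rewrite ger0_norm ?subr_ge0|rewrite ltr0_norm ?subr_lt0// opprB].
apply: overlap_bound => // [i im|y].
  have /andP[h1 h2] := hI _ (p01 _ (ltnW im)).
  have /andP[h3 h4] := hI _ (p01 _ im).
  by rewrite /a /b le_min h1 h3 ge_max h2 h4 ge_min le_max lexx.
have ex i : exists t, (i < size s)%N -> a i < y < b i ->
    p i < t < p i.+1 /\ h t = y.
  have [im|im] := ltnP i (size s); last by exists 0.
  have [yI|yI] := boolP (a i < y < b i); last by exists 0.
  have pp : p i <= p i.+1 by exact/ltW/(itv_partition_lt P).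
  have ch' : {within `[p i, p i.+1], continuous h}.
    apply: continuous_subspaceW ch => x /=; rewrite !in_itv/= => /andP[h1 h2].
    have /andP[h3 h4] := p01 _ (ltnW im); have /andP[h5 h6] := p01 _ im.
    by rewrite (le_trans h3 h1) (le_trans h2 h6).
  have [|t] := IVT pp ch' (v := y).
    by case/andP: yI => h1 h2; rewrite -/(a i) -/(b i) !ltW.
  rewrite in_itv/= => /andP[t1 t2] hty; exists t => _ _; split => //.
  rewrite !lt_def t1 t2 !andbT; apply/andP; split; apply/eqP => tp; move: yI.
    by rewrite -hty tp /a /b; case: (leP (h (p i)) (h (p i.+1))); rewrite ltxx ?andbF.
  by rewrite -hty -tp /a /b; case: (leP (h (p i)) (h (p i.+1))); rewrite ltxx ?andbF.
have /choice[t ht] := ex.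
pose I := [seq i <- iota 0 (size s) | a i < y < b i].
have IP i : i \in I -> p i < t i < p i.+1 /\ h (t i) = y.
  by rewrite mem_filter mem_iota => /andP[yI im]; exact: ht.
have Is i : i \in I -> (i < size s)%N.
  by rewrite mem_filter mem_iota => /andP[].
rewrite -size_filter -/I -(size_map t); apply: (hn y).
  rewrite map_inj_in_uniq ?filter_uniq ?iota_uniq// => i j iI jI tij.
  wlog ij : i j iI jI tij / (i <= j)%N.
    by move=> W; have [ij|/ltnW ij] := leqP i j; [exact: W|apply/esym/W].
  move: ij; rewrite leq_eqVlt => /predU1P[//|ij].
  have [/andP[_ h1] _] := IP i iI; have [/andP[h2 _] _] := IP j jI.
  have h3 : p i.+1 <= p j by rewrite (itv_partition_nth_mono P)// ij ltnW// Is.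
  by have := lt_trans (lt_le_trans h1 h3) h2; rewrite tij ltxx.
move=> _ /mapP[i iI ->]; have [/andP[h1 h2] ->] := IP i iI; split=> //.
have /andP[h3 _] := p01 i (ltnW (Is i iI)).
have /andP[_ h4] := p01 i.+1 (Is i iI).
by rewrite (le_trans h3 (ltW h1)) (le_trans (ltW h2) h4).
Qed.

End Variation.

(** * Gauss-Lucas and convex hulls *)

Section LiftContinuity.
Variables (R : realType) (f : {poly R[i]}).
Hypothesis f1 : (1 < size f)%N.
Implicit Types (g : R -> R[i]) (e d s t : R).

Lemma lift_cts g e : is_lift f g -> 0 < e -> exists2 d, 0 < d &
  forall s t, 0 <= s <= 1 -> 0 <= t <= 1 -> `|s - t| <= d ->
    normc (g s - g t) <= e.
Proof.
move=> [_ g2] e0; have N0 : (0 < (size f).-1)%N by case: (size f) f1 => [|[]].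
pose k := e / (2 * (size f).-1%:R).
have N0' : 0 < 2 * (size f).-1%:R :> R by rewrite mulr_gt0 ?ltr0n.
have k0 : 0 < k by rewrite divr_gt0.
have w0 : 0 < normc f.[g 1] + 1 by rewrite ltr_wpDl// normc_ge0.
exists (k ^+ (size f).-1 / (normc f.[g 1] + 1)).
  by rewrite divr_gt0// exprn_gt0.
move=> s t s01 t01; rewrite ler_pdivlMr// => h.
rewrite (le_trans (g2 s t k s01 t01 (ltW k0) _))//.
  by rewrite (le_trans _ h)// mulrC ler_wpM2l// lerDl.
by rewrite mulrCA mulrA mulrC divfK ?gt_eqF.
Qed.

End LiftContinuity.

Section Dot.
Variable R : realType.
Implicit Types (u v x y z : R[i]) (k : R).

Definition dot u z : R := re u * re z + im u * im z.

Lemma dotE u z : dot u z = re (u^*%C * z).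
Proof. by case: u z => [a b] [c d]; rewrite /dot/=; ring. Qed.

Lemma dotiE u z : dot ('i * u) z = im (u^*%C * z).
Proof. by case: u z => [a b] [c d]; rewrite /dot/=; ring. Qed.

Lemma dotD u x y : dot u (x + y) = dot u x + dot u y.
Proof. by case: u x y => [a b] [c d] [m n]; rewrite /dot/=; ring. Qed.

Lemma dotN u x : dot u (- x) = - dot u x.
Proof. by case: u x => [a b] [c d]; rewrite /dot/=; ring. Qed.

Lemma dotB u x y : dot u (x - y) = dot u x - dot u y.
Proof. by rewrite dotD dotN. Qed.

Lemma dotZ u k x : dot u (k%:C * x) = k * dot u x.
Proof. by case: u x => [a b] [c d]; rewrite /dot/=; ring. Qed.

Lemma dotxx x : dot x x = normc x ^+ 2.
Proof.
by case: x => a b; rewrite /dot /= sqr_sqrtr ?addr_ge0 ?sqr_ge0// !expr2.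
Qed.

Lemma normcJ u : normc u^*%C = normc u.
Proof. by case: u => a b; rewrite /= sqrrN. Qed.

Lemma dot_le u z : `|dot u z| <= normc u * normc z.
Proof. by rewrite dotE (le_trans (Re_le_normc _))// normcM normcJ. Qed.

(** The two scalar products are the real and imaginary parts of the conjugate of [u] times [z];
    projections on two orthogonal directions thus control lengths. *)
Lemma normc_le_dot u z : normc u * normc z <= `|dot u z| + `|dot ('i * u) z|.
Proof. by rewrite dotE dotiE -{1}(normcJ u) -normcM normc_le_ReIm. Qed.

(* All the summands [1 / (x - r)] of [p'(x) / p(x)] lie in the half-plane
   [re (u z) > 0]. *)
Lemma logderiv_halfplane (rs : seq R[i]) u x : rs != [::] ->
  (forall r, r \in rs -> 0 < dot u (x - r)) ->
  let p := \prod_(r <- rs) ('X - r%:P) in 0 < dot (u * p^`().[x]) p.[x].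
Proof.
elim: rs => [//|r rs IH] _ hrs /=; rewrite big_cons.
set p := \prod_(_ <- _) _; rewrite poly.derivM poly.derivXsubC mul1r.
rewrite hornerD !hornerM hornerXsubC.
have px : p.[x] != 0.
  rewrite -[_ == 0]/(root p x) root_prod_XsubC; apply/negP => xrs.
  have := hrs x; rewrite inE xrs orbT subrr => /(_ isT).
  by rewrite /dot /= !mulr0 addr0 ltxx.
have h1 : 0 < dot u (x - r) by apply: hrs; rewrite inE eqxx.
have h2 : 0 <= dot (u * p^`().[x]) p.[x].
  have [rs0|rs0] := eqVneq rs [::].
    by rewrite /p rs0 big_nil derivC horner0 mulr0 /dot !mul0r addr0.
  by apply/ltW/IH => // r' r'rs; apply: hrs; rewrite inE r'rs orbT.
move: px h1 h2; move: p.[x] p^`().[x] (x - r) => a b d a0 h1 h2.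
have -> : dot (u * (a + d * b)) (d * a) =
    normc a ^+ 2 * dot u d + normc d ^+ 2 * dot (u * b) a.
  rewrite -!dotxx; case: (u) a b d {a0 h1 h2} => [? ?] [? ?] [? ?] [? ?].
  by rewrite /dot /=; ring.
by rewrite ltr_pwDl ?mulr_gt0 ?exprn_gt0 ?normc_gt0// mulr_ge0 ?exprn_ge0 ?normc_ge0.
Qed.

End Dot.

Section GaussLucas.
Variables (R : realType) (f : {poly R[i]}).
Hypotheses (fm : f \is monic) (f1 : (1 < size f)%N).
Implicit Types (g : R -> R[i]) (e d s t k : R).

(** Suppose that a farthest point of the lift in direction [u] lies beyond [k]. By the logarithmic
    derivative, [f] has non-zero derivative there and raising the parameter moves the lift still
    farther. The parameter would have to be 1, but the derivative vanishes at [g 1]. *)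
Lemma lift_halfplane g u k : is_lift f g -> root f^`() (g 1) ->
  (forall r, root f r -> dot u r <= k) ->
  forall s, 0 <= s <= 1 -> dot u (g s) <= k.
Proof.
move=> lg cr hk s s01; rewrite leNgt; apply/negP => ks.
have ch : {within `[0, 1], continuous (fun t => dot u (g t))}.
  apply: within_continuous_eps => x e /=; rewrite in_itv/= => x01 e0.
  have u0 : 0 < normc u + 1 by rewrite ltr_wpDl// normc_ge0.
  have [d d0 hd] := lift_cts f1 lg (divr_gt0 e0 u0); exists d => // y.
  rewrite in_itv/= => y01 yx; rewrite -dotB (le_trans (dot_le _ _))//.
  have := hd y x y01 x01 yx; rewrite ler_pdivlMr// => h.
  by rewrite (le_trans _ h)// mulrC ler_wpM2l ?normc_ge0// lerDl.
have [s' + smax] := EVT_max ler01 ch; rewrite in_itv/= => s'01.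
set x := g s' in smax.
have kx : k < dot u x by apply: lt_le_trans ks _; apply: smax; rewrite in_itv.
have [lg1 _] := lg; set w := f.[g 1] in lg1.
have fx : f.[x] = s'%:C * w by exact: lg1.
have [rs fE srs] := monic_split fm.
have rs0 : rs != [::].
  by apply/eqP => rs0; move: srs f1; rewrite rs0 /=; case: (size f) => [|[]].
have hrs r : r \in rs -> 0 < dot u (x - r).
  move=> rrs; rewrite dotB subr_gt0 (le_lt_trans _ kx)// hk//.
  by rewrite fE root_prod_XsubC.
have := logderiv_halfplane rs0 hrs; rewrite /= -fE fx => h.
have {}h : 0 < s' * dot u (w * (f^`().[x])^*%C).
  rewrite -dotZ; rewrite (_ : dot u _ = dot (u * f^`().[x]) (s'%:C * w))//.
  case: (u) (f^`().[x]) (w) => [? ?] [? ?] [? ?].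
  by rewrite /dot /=; ring.
have s'0 : 0 < s'.
  rewrite lt_def; case/andP: s'01 => -> _; rewrite andbT.
  by apply: contraTneq h => ->; rewrite mul0r ltxx.
rewrite pmulr_rgt0// in h; set v := f^`().[x] in h.
have s'1 : s' < 1.
  rewrite lt_def andbC; case/andP: (s'01) => _ -> /=.
  apply/eqP => s'1; move: h; rewrite /v /x -s'1 (eqP cr).
  by rewrite conjc0 mulr0 /dot /= !mulr0 addr0 ltxx.
have [q qE qx] := poly_factor f x.
have quw : 0 < normc u * normc w + 1.
  by rewrite ltr_wpDl// mulr_ge0 ?normc_ge0.
(* This tolerance on the difference quotient costs at most half of the positive quantity in [h]. *)
pose e := dot u (w * v^*%C) / 2 / (normc u * normc w + 1).
have e0 : 0 < e by rewrite !divr_gt0.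
have [d d0 hd] := poly_cts q x e0.
have [d' d'0 hd'] := lift_cts f1 lg d0.
pose t := Num.min 1 (s' + d').
have st : s' < t by rewrite lt_min s'1 ltrDl.
have t01 : 0 <= t <= 1.
  by rewrite ge_min lexx andbT (le_trans _ (ltW st))//; case/andP: s'01.
have ts : `|t - s'| <= d'.
  by rewrite gtr0_norm ?subr_gt0// lerBlDl ge_min lexx orbT.
have := hd _ (hd' t s' t01 s'01 ts); rewrite qx -/v => hq.
have hgt : q.[g t] * (g t - x) = (t - s')%:C * w.
  have := congr1 (horner^~ (g t)) qE; rewrite !hornerE fx lg1// => <-.
  by rewrite rmorphB mulrBl.
have gtx : dot u (g t - x) <= 0.
  by rewrite dotB subr_le0 smax// in_itv.
(* Multiplying by the conjugate of the difference quotient spares a division by it. *)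
have h3 : (t - s') * dot u (w * q.[g t]^*%C) = normc q.[g t] ^+ 2 * dot u (g t - x).
  rewrite -!dotZ; congr dot; rewrite mulrA -hgt -dotxx.
  move: (q.[g t]) (g t - x) => [a b] [c m]; apply/eqP.
  by rewrite eq_complex /dot /=; apply/andP; split; apply/eqP; ring.
have h4 : dot u (w * q.[g t]^*%C) <= 0.
  rewrite -(pmulr_rle0 _ (x := t - s')) ?subr_gt0// h3.
  by rewrite mulr_ge0_le0// exprn_ge0// normc_ge0.
have h5 : dot u (w * v^*%C) <= normc u * normc w * e.
  have -> : v = q.[g t] - (q.[g t] - v) by rewrite opprB addrC subrK.
  rewrite rmorphB mulrBr dotB lerBlDr (le_trans h4)//.
  have := dot_le u (w * (q.[g t] - v)^*%C); rewrite normcM normcJ ler_norml mulrA.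
  move=> /andP[h6 _]; rewrite -lerBlDr sub0r lerNl (le_trans _ h6)// lerN2.
  by rewrite ler_wpM2l ?mulr_ge0 ?normc_ge0.
have h7 : (normc u * normc w + 1) * e = dot u (w * v^*%C) / 2.
  by rewrite /e mulrC divfK ?gt_eqF.
rewrite mulrDl mul1r in h7.
by move: h5 h7 e0 h; clear; lra.
Qed.

End GaussLucas.

(** * Convex hulls of finite sets *)

Section Hull.
Variable R : realType.
Implicit Types (l : seq R[i]) (a p q z : R[i]) (s t e : R).

(** The convex hull of a list as an iterated join of segments, which gives induction without
    barycentric weights. The clause [p = a] is what covers a one-point list. *)
Fixpoint seq_hull l p : Prop :=
  if l is a :: l' then p = a \/ exists s q,
    [/\ 0 <= s <= 1, seq_hull l' q & p = a + s%:C * (q - a)]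
  else False.

Lemma seq_hull_sub l (C : set R[i]) p : @convex_set R (Rcomplex R) C ->
  (forall a, a \in l -> C a) -> seq_hull l p -> C p.
Proof.
move=> cC; elim: l p => [//|a l IH] p lC /= [->|].
  by apply: lC; rewrite inE eqxx.
move=> [s [q [s01 lq ->]]].
have Cq : C q by apply: IH => // b bl; apply: lC; rewrite inE bl orbT.
have Ca : C a by apply: lC; rewrite inE eqxx.
case/andP: s01 => s0 s1.
have := cC q a (Itv01 s0 s1); rewrite !inE => /(_ Cq Ca).
congr C; rewrite /conv/=.
move: q a {lC Cq Ca IH lq} => [c d] [x y].
rewrite /unstable.onem; apply/eqP; rewrite eq_complex /=; apply/andP; split; apply/eqP; ring.
Qed.

Lemma seq_hull_bounded l : exists M, forall p, seq_hull l p -> normc p <= M.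
Proof.
elim: l => [|a l [M hM]]; first by exists 0.
exists (normc a + (`|M| + normc a)) => p [->|[s [q [/andP[s0 s1] /hM qM ->]]]].
  by rewrite lerDl addr_ge0 ?normc_ge0.
rewrite (le_trans (normcD _ _))// lerD2l normcM normcR ger0_norm//.
rewrite (@le_trans _ _ (normc (q - a)))// ?ler_piMl ?normc_ge0//.
have := normcD q (- a); rewrite normcNE; have := ler_norm M; lra.
Qed.

Lemma seq_hull_mem l a : a \in l -> seq_hull l a.
Proof.
elim: l => [//|b l IH]; rewrite inE => /predU1P[->|/IH lb]; first by left.
right; exists 1, a; split=> //; first by rewrite ler01 lexx.
by rewrite mul1r addrC subrK.
Qed.

(** Convexity towards the points of the list is all that the nearest point argument asks for. *)
Lemma seq_hull_star l p a t : seq_hull l p -> a \in l -> 0 <= t <= 1 ->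
  seq_hull l (p + t%:C * (a - p)).
Proof.
elim: l p a t => [//|c l IH] p a t hp; rewrite inE => al /andP[t0 t1].
case: hp => [->|[s [q [/andP[s0 s1] lq ->]]]].
  case/predU1P: al => [->|al]; first by left; rewrite subrr mulr0 addr0.
  right; exists t, a; split; [by rewrite t0 t1|exact: seq_hull_mem|by []].
case/predU1P: al => [->|al].
  right; exists ((1 - t) * s), q; split=> //.
    by apply/andP; split; nra.
  by rewrite rmorphM rmorphB rmorph1; ring.
(* [S] is the weight not carried by [c], and [t / S] is the share of [a] in it. *)
right; pose S := (1 - t) * s + t.
have [S0|S0] := eqVneq S 0.
  have ts0 : 0 <= (1 - t) * s by rewrite mulr_ge0 ?subr_ge0.
  have t'0 : t = 0 by move: S0; rewrite /S; lra.
  by exists s, q; rewrite s0 s1; split=> //; rewrite t'0 mul0r addr0.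
have tS : t <= S by rewrite lerDr mulr_ge0 ?subr_ge0.
have Sp : 0 < S by rewrite lt_def S0 (le_trans t0).
exists S, (q + (t / S)%:C * (a - q)); split.
- rewrite ltW//= /S -lerBrDr ler_piMr// subr_ge0//.
- by apply: IH => //; rewrite divr_ge0 ?(ltW Sp)//= ler_pdivrMr// mul1r.
- have tSE : t = (t / S) * S by rewrite divfK.
  move: (t / S) tSE => k; rewrite /S => tSE.
  have {}tSE : t%:C = k%:C * ((1 - t%:C) * s%:C + t%:C).
    rewrite -[1](rmorph1 (real_complex R)) -rmorphB -rmorphM -rmorphD -rmorphM.
    by rewrite -tSE.
  rewrite !(rmorphM, rmorphD, rmorphN, rmorph1)/=.
  move: tSE; move: (t%:C) (s%:C) (k%:C) => T S' K hT.
  transitivity (c + ((1 - T) * S' + T) * (q - c) + K * ((1 - T) * S' + T) * (a - q)).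
    by rewrite -hT; ring.
  ring.
Qed.

(** By induction: the coefficient and the point of the shorter hull are bounded, hence both converge
    along [U]. *)
Lemma seq_hull_closed (U : set_system nat) l (p : nat -> R[i]) q :
  UltraFilter U -> U [set n | seq_hull l (p n)] ->
  (forall e, 0 < e -> U [set n | normc (p n - q) <= e]) -> seq_hull l q.
Proof.
move=> UU; elim: l p q => [|a l IH] p q hp hq.
  by have [] := filter_ex hp.
have [pa|pna] := in_ultra_setVsetC [set n | p n = a] UU.
  left; apply/eqP; rewrite -subr_eq0; apply/eqP/normc_le_eq0 => e e0.
  have [n [/= + h]] := filter_ex (filterI pa (hq e e0)).
  by move: h => /[swap] ->; rewrite normcBC.
have [M hM] := seq_hull_bounded l.
(* The pair (0, 0) is a bounded default for the indices at which [p n] is not on such a segment. *)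
have /choice[F hF] (n : nat) : exists F : R * R[i],
    [/\ `|F.1| <= 1, normc F.2 <= `|M| &
     seq_hull (a :: l) (p n) -> p n <> a ->
     [/\ 0 <= F.1, seq_hull l F.2 & p n = a + F.1%:C * (F.2 - a)]].
  have [[s [t [/andP[s0 s1] lt pE]]]|H] := pselect (exists s r,
      [/\ 0 <= s <= 1, seq_hull l r & p n = a + s%:C * (r - a)]).
    exists (s, t); split=> //=; first by rewrite ger0_norm.
    by rewrite (le_trans (hM _ lt))// ler_norm.
  exists (0, 0); split.
  - by rewrite normr0.
  - by rewrite [leLHS]normc0.
  - by move=> [pa|/H].
have F1 n : `|(F n).1| <= 1 by case: (hF n).
have F2 n : normc (F n).2 <= `|M| by case: (hF n).
have [s hs] := ultralimit UU F1; have [t ht] := ultralimitc UU F2.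
have G : U [set n | [/\ 0 <= (F n).1, seq_hull l (F n).2 &
     p n = a + (F n).1%:C * ((F n).2 - a)]].
  by apply: filterS2 hp pna => n /= h1 h2; have [_ _] := hF n; exact.
have s01 : 0 <= s <= 1.
  apply/andP; split; apply/ler_addgt0Pr => e e0.
      have [n [/= + [h _ _]]] := filter_ex (filterI (hs e e0) G).
      by rewrite ler_norml => /andP[_]; lra.
  have [n /= +] := filter_ex (hs e e0); rewrite ler_norml => /andP[+ _].
  by have [+ _ _] := hF n; rewrite ler_norml => /andP[_]; lra.
right; exists s, t; split=> //.
  by apply: IH (fun n => (F n).2) _ _ ht; apply: filterS G => n [].
apply/eqP; rewrite -subr_eq0; apply/eqP/normc_le_eq0 => e e0.
pose e' := e / (2 + `|M| + normc a).
have D0 : 0 < 2 + `|M| + normc a by rewrite !ltr_pwDl ?normc_ge0.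
have e'0 : 0 < e' by rewrite divr_gt0.
have [n [[/= n1 n2] [n3 [_ _ pE]]]] := filter_ex (filterI
  (filterI (hs _ e'0) (ht _ e'0)) (filterI (hq _ e'0) G)).
have -> : q - (a + s%:C * (t - a)) = - (p n - q) +
   (((F n).1 - s)%:C * ((F n).2 - a) + s%:C * ((F n).2 - t)).
  by rewrite pE rmorphB; ring.
have FM : normc ((F n).2 - a) <= `|M| + normc a.
  by have [_ h _] := hF n; have := normcD (F n).2 (- a); rewrite normcNE; lra.
have h1 : normc ((F n).1 - s)%:C * normc ((F n).2 - a) <= e' * (`|M| + normc a).
  by apply: ler_pM; rewrite ?normc_ge0// normcR.
have h2 : normc s%:C * normc ((F n).2 - t) <= 1 * e'.
  by apply: ler_pM; rewrite ?normc_ge0// normcR; case/andP: s01 => *; rewrite ger0_norm.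
have eE : e = e' + (e' * (`|M| + normc a) + 1 * e').
  transitivity (e' * (2 + `|M| + normc a)); last by ring.
  by rewrite divfK ?gt_eqF.
rewrite eE (le_trans (normcD _ _))// normcNE lerD// (le_trans (normcD _ _))//.
by rewrite !normcM lerD.
Qed.

Lemma seq_hull_nearest l z : l != [::] -> exists2 q, seq_hull l q &
  forall p, seq_hull l p -> normc (z - q) <= normc (z - p).
Proof.
case: l => [//|a0 l' _]; set l := a0 :: l'.
pose E : set R := [set normc (z - p) | p in seq_hull l].
have hE : has_inf E.
  split; first by exists (normc (z - a0)), a0 => //; left.
  by exists 0 => _ [p _ <-]; exact: normc_ge0.
have /choice[p hp] (n : nat) : exists p, seq_hull l p /\
    normc (z - p) <= inf E + n.+1%:R^-1.
  have n0 : 0 < n.+1%:R^-1 :> R by rewrite invr_gt0.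
  by have [_ [p lp <-] /ltW h] := inf_adherent n0 hE; exists p.
have [M hM] := seq_hull_bounded l.
have [U [UU ooU]] := ultraFilterLemma eventually_filter.
have [q hq] := ultralimitc UU (fun n => hM _ (hp n).1).
exists q.
  apply: (seq_hull_closed UU _ hq); apply: filterS filterT => n _.
  exact: (hp n).1.
move=> r lr; have ir : inf E <= normc (z - r) by apply: ge_inf; [case: hE|exists r].
apply: (le_trans _ ir); apply/ler_addgt0Pr => e e0.
have e2 : 0 < e / 2 by rewrite divr_gt0.
have Usmall := ooU _ (near_infty_natSinv_lt (PosNum e2)).
have [n [/= h1 /ltW /= h2]] := filter_ex (filterI (hq _ e2) Usmall).
have := normc_triangle (p n) z q; have [_ h3] := hp n.
have h4 : inf E + n.+1%:R^-1 <= inf E + e / 2 by rewrite lerD2l.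
by have := le_trans h3 h4; lra.
Qed.

(** Separation by projection: [A] lies on the far side of the perpendicular to [z - q] at the
    nearest point [q] of the hull, and the hypothesis for that half-plane gives
    [normc (z - q) ^+ 2 <= 0]. *)
Lemma convex_hull_halfplanes (A : {fset R[i]}) z : A != fset0 ->
  (forall u k, (forall a, a \in A -> dot u a <= k) -> dot u z <= k) ->
  convex_hull [set` A] z.
Proof.
move=> A0 H; have lA : enum_fset A != [::].
  apply: contra A0 => /eqP A0; apply/eqP/fsetP => x.
  by rewrite in_fset0 -[x \in A]/(x \in enum_fset A) A0.
have [q lq qmin] := seq_hull_nearest z lA.
suff zq : z = q.
  move=> C [cC AC]; rewrite zq; apply: (seq_hull_sub cC _ lq) => a aA.
  exact: AC.
have h a : a \in A -> dot (z - q) (a - q) <= 0.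
  move=> aA; rewrite leNgt; apply/negP; set D := dot _ _ => D0.
  have K0 : 0 < normc (a - q) ^+ 2 + 1 by rewrite ltr_wpDl// sqr_ge0.
  (* Moving from [q] towards [a] by [t] changes the squared distance to [z] by
     [t ^+ 2 * normc (a - q) ^+ 2 - 2 * t * D], which is negative for this [t]. *)
  pose t := Num.min 1 (D / (normc (a - q) ^+ 2 + 1)).
  have t0 : 0 < t by rewrite lt_min ltr01 divr_gt0.
  have t1 : t <= 1 by rewrite ge_min lexx.
  have tD : t * (normc (a - q) ^+ 2 + 1) <= D.
    by rewrite -ler_pdivlMr// ge_min lexx orbT.
  have t01 : 0 <= t <= 1 by rewrite ltW.
  have := qmin _ (seq_hull_star lq aA t01).
  rewrite -(ler_pXn2r (ltn0Sn 1)) ?nnegrE ?normc_ge0// -!dotxx.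
  rewrite (_ : dot (z - (q + _)) _ =
    dot (z - q) (z - q) - 2 * t * D + t ^+ 2 * normc (a - q) ^+ 2); last first.
    rewrite -dotxx /D; move: (z) (a) (q) (t) => [? ?] [? ?] [? ?] ?.
    by rewrite /dot /=; ring.
  have := ler_wpM2l (ltW t0) tD; have := mulr_gt0 t0 D0; have := mulr_gt0 t0 t0.
  by clear; move: (dot (z - q) (z - q)) (normc _ ^+ 2) => X K; clearbody t D; lra.
have := H (z - q) (dot (z - q) q).
have hA a : a \in A -> dot (z - q) a <= dot (z - q) q.
  by move=> /h; rewrite dotB subr_le0.
move=> /(_ hA); rewrite -subr_le0 -dotB dotxx => h0.
apply/eqP; rewrite -subr_eq0 -normc0P -(sqrf_eq0 (normc _)).
by rewrite eq_le h0 sqr_ge0.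
Qed.

End Hull.

(** * Curves on which f is real up to a factor *)

Section Limits.
Variable R : realType.
Implicit Types (F G : R -> R[i]) (l : R[i]) (a b s t e d : R).

Lemma complex_pos (e : R[i]) : 0 < e -> exists2 k : R, 0 < k & e = k%:C.
Proof. by case: e => a b; rewrite ltcE /= => /andP[/eqP-> a0]; exists a. Qed.

Lemma within_dnbhs_near (P : R -> Prop) a b t :
  (exists2 d, 0 < d & forall u, a <= u <= b -> u != t -> `|u - t| <= d -> P u) ->
  within `[a, b] t^' P.
Proof.
move=> [d d0 hd]; rewrite /within /dnbhs /= /within /=.
apply: filterS (nbhsx_ballx t d d0) => u ut u0 uI; apply: hd => //.
by rewrite distrC ltW.
Qed.

Lemma cvg_within_dnbhs F l a b t :
  (forall e, 0 < e -> exists2 d, 0 < d &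
     forall u, a <= u <= b -> u != t -> `|u - t| <= d -> normc (F u - l) <= e) ->
  (F : R -> R[i]^o) @ within `[a, b] t^' --> (l : R[i]^o).
Proof.
move=> H; apply/cvgrPdist_le => e /complex_pos[k k0 ->].
apply: within_dnbhs_near; have [d d0 hd] := H k k0; exists d => // u uI ut ud.
by rewrite distrC -normcE lecR hd.
Qed.

Lemma within_continuous_epsc F a b :
  (forall e, 0 < e -> exists2 d, 0 < d &
     forall s t, a <= s <= b -> a <= t <= b -> `|s - t| <= d ->
       normc (F s - F t) <= e) ->
  {within `[a, b], continuous (F : R -> R[i]^o)}.
Proof.
move=> H; apply/subspace_continuousP => x Ax; apply/cvgrPdist_le => _ /complex_pos[k k0 ->].
have [d d0 hd] := H k k0; rewrite near_withinE.
apply: filterS (nbhsx_ballx x d d0) => y xy Ay.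
by rewrite -normcE lecR; apply: hd; [| |exact: ltW].
Qed.

End Limits.

(** * Zeros of an imaginary part on lines *)

Section RealLines.
Variable R : realType.
Implicit Types (f p : {poly R[i]}) (v w z : R[i]).

Lemma im_horner p (x : R) :
  im p.[x%:C] = (\poly_(j < size p) im p`_j).[x].
Proof.
rewrite horner_poly horner_coef.
have imD : {morph (fun z : R[i] => im z) : a b / a + b >-> a + b}.
  by move=> [? ?] [? ?].
rewrite (big_morph _ imD (erefl : im 0 = 0)); apply: eq_bigr => j _.
by rewrite -rmorphXn; case: (p`_j) => a b /=; ring.
Qed.

(* On the line [dot v z = y], which has direction [i v], the imaginary part of
   [f / w] is a real polynomial of the same degree as [f]. *)
Lemma line_count f v w (y : R) (zs : seq R[i]) : f \is monic ->
  (1 < size f)%N -> im (('i * v) ^+ (size f).-1 * w^*%C) != 0 -> uniq zs ->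
  (forall z, z \in zs -> dot v z = y /\ im (f.[z] * w^*%C) = 0) ->
  (size zs <= (size f).-1)%N.
Proof.
move=> fm f1 hv uzs hzs.
have N0 : (0 < (size f).-1)%N by case: (size f) f1 => [|[]].
have v0 : v != 0.
  apply: contra hv => /eqP ->; rewrite mulr0 expr0n gtn_eqF//= mul0r.
  by rewrite eqxx.
have nv0 : 0 < normc v ^+ 2 by rewrite exprn_gt0// normc_gt0.
(* [c0] is the foot of the perpendicular from 0, so that [q] parametrizes the line by the real
   numbers. *)
pose c1 := 'i * v; pose c0 := (y / normc v ^+ 2)%:C * v.
pose q : {poly R[i]} := c1 *: 'X + c0%:P.
have c10 : c1 != 0.
  by rewrite mulf_neq0// eq_complex /= oner_eq0 andbF.
have sq : size q = 2%N.
  by rewrite /q size_polyDl size_scale// size_polyX// ltnS size_polyC_leq1.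
have lq : lead_coef q = c1.
  by rewrite /q lead_coefDl ?lead_coefZ ?lead_coefX ?mulr1// size_scale// size_polyX
     ltnS size_polyC_leq1.
have w0 : w^*%C != 0.
  by apply: contra hv => /eqP ->; rewrite mulr0.
pose p := w^*%C *: (f \Po q).
have sp : size p = size f.
  by rewrite /p size_scale// size_comp_poly2.
have pN : p`_(size f).-1 = c1 ^+ (size f).-1 * w^*%C.
  rewrite -[in LHS]sp -lead_coefE /p lead_coefZ lead_coef_comp ?sq// lq.
  by rewrite (monicP fm) mul1r mulrC.
pose x z := dot ('i * v) z / normc v ^+ 2.
have zE z : dot v z = y -> q.[(x z)%:C] = z.
  move=> zy; rewrite /q !hornerE /c1 /c0 /x -zy.
  apply: (mulfI (x := (normc v ^+ 2)%:C)); first by rewrite eq_complex /= gt_eqF.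
  have h k : (normc v ^+ 2)%:C * (k / normc v ^+ 2)%:C = k%:C.
    by rewrite -rmorphM mulrCA divff ?mulr1// gt_eqF.
  rewrite mulrDr mulrCA h mulrA h -dotxx; clear.
  case: v z => [a b] [c d]; apply/eqP; rewrite eq_complex /dot /=.
  by apply/andP; split; apply/eqP; ring.
pose F := \poly_(j < size p) im p`_j.
(* The coefficient of degree [(size f).-1] is the number assumed non-zero in [hv]. *)
have F0 : F != 0.
  apply/eqP => /(congr1 (fun r : {poly R} => r`_(size f).-1)).
  rewrite coef_poly sp -[X in (_ < X)%N](ltn_predK f1) leqnn pN coef0 => /eqP.
  exact/negP.
have sF : (size F <= size f)%N by rewrite -sp size_poly.
have := @max_poly_roots _ F [seq x z | z <- zs] F0.
rewrite size_map => h; rewrite -ltnS (ltn_predK f1).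
apply: (leq_trans _ sF); apply: h.
- apply/allP => _ /mapP[z zzs ->]; have [zy zi] := hzs z zzs.
  by rewrite /root -im_horner /p hornerZ horner_comp zE// mulrC zi.
- rewrite map_inj_in_uniq// => z z' /hzs[zy _] /hzs[z'y _] xz.
  by rewrite -(zE z zy) xz zE.
Qed.

(** If [u ^+ n = w * (1 + 'i)], both numbers are imaginary parts of some
    [normc w ^+ 2 * 'i ^+ m * (1 + 'i)], and no power of ['i] turns [1 + 'i] onto the real axis. *)
Lemma exists_direction n w : (0 < n)%N -> w != 0 -> exists u,
  [/\ u != 0, im (('i * u) ^+ n * w^*%C) != 0 &
      im (('i * ('i * u)) ^+ n * w^*%C) != 0].
Proof.
move=> n0 w0; pose u := n.-root (w * (1 + 'i)); exists u.
have un : u ^+ n = w * (1 + 'i) by rewrite rootCK.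
have i4 : 'i ^+ 2 = -1 :> R[i] by rewrite sqr_i.
have w0' : 0 < normc w ^+ 2 by rewrite exprn_gt0// normc_gt0.
have ww : w * w^*%C = (normc w ^+ 2)%:C.
  rewrite -dotxx; case: (w) => a b; apply/eqP; rewrite eq_complex /dot /=.
  by apply/andP; split; apply/eqP; ring.
have key m : im ('i ^+ m * (1 + 'i) : R[i]) != 0.
  elim/ltn_ind: m => -[|[|m]] IH.
  - by rewrite expr0 mul1r /= add0r oner_eq0.
  - by rewrite expr1 /= !(mul0r, mulr0, add0r, addr0, mul1r, oppr0) oner_eq0.
  - rewrite -addn2 exprD i4 mulrN1 mulNr; have := IH m (leqnSn _).
    by case: (_ * _) => a b /=; rewrite oppr_eq0.
have imk m : im ('i ^+ m * u ^+ n * w^*%C) != 0.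
  rewrite un -!mulrA (mulrC w) -mulrA (mulrC w^*%C) ww mulrA.
  have := key m; case: (_ * _) => a b /= b0.
  by rewrite mulr0 add0r mulf_neq0// gt_eqF.
split.
- apply/eqP => u0; have := imk 0%N; rewrite u0 expr0n gtn_eqF//=.
  by rewrite mulr0 mul0r eqxx.
- by rewrite exprMn imk.
- by rewrite mulrA exprMn -expr2 -exprM imk.
Qed.

End RealLines.

(** * Regularity and length of descent paths *)

Section Reparametrization.
Variables (R : realType) (f : {poly R[i]}).
Hypotheses (fm : f \is monic) (f1 : (1 < size f)%N).
Local Notation N := (size f).-1.
Implicit Types (P q : {poly R}) (x y s t u d e l h k m : R) (g gam : R -> R[i]).

Lemma real_poly_lip P : exists2 L, 0 <= L & forall x y,
  0 <= x <= 1 -> 0 <= y <= 1 -> `|P.[x] - P.[y]| <= L * `|x - y|.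
Proof.
elim/poly_ind: P => [|P c [L L0 hL]].
  by exists 0 => // x y _ _; rewrite !horner0 subrr normr0 mul0r.
have [B B0 hB] := real_poly_bounded P.
exists (B + L) => [|x y x01 y01]; first by rewrite addr_ge0.
rewrite !hornerMXaddC.
have -> : P.[x] * x + c - (P.[y] * y + c) = P.[x] * (x - y) + (P.[x] - P.[y]) * y.
  by ring.
rewrite (le_trans (ler_normD _ _))// [leRHS]mulrDl lerD// normrM.
  by rewrite ler_wpM2r// hB.
rewrite (@le_trans _ _ `|P.[x] - P.[y]|)//; last exact: hL.
by rewrite ler_piMr//; case/andP: y01 => *; rewrite ger0_norm.
Qed.

Section OnePiece.
Variables (g gam : R -> R[i]) (P : {poly R}) (k m l h : R).
Hypothesis lg : is_lift f g.
Hypothesis PI : forall x, 0 <= x <= 1 -> 0 <= P.[x] <= 1.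
Hypothesis kmI : forall t, l <= t <= h -> 0 <= k * t + m <= 1.
Hypothesis gamE : forall t, l <= t <= h -> gam t = g P.[k * t + m].

Lemma piece_cts e : 0 < e -> exists2 d, 0 < d &
  forall s t, l <= s <= h -> l <= t <= h -> `|s - t| <= d ->
    normc (gam s - gam t) <= e.
Proof.
move=> e0; have [d d0 hd] := lift_cts f1 lg e0; have [L L0 hL] := real_poly_lip P.
have K0 : 0 < L * `|k| + 1 by rewrite ltr_wpDl// mulr_ge0.
exists (d / (L * `|k| + 1)); first by rewrite divr_gt0.
move=> s t sI tI; rewrite ler_pdivlMr// => h'; rewrite !gamE//.
apply: hd; [exact/PI/kmI|exact/PI/kmI|].
rewrite (le_trans (hL _ _ (kmI sI) (kmI tI)))//.
have -> : k * s + m - (k * t + m) = k * (s - t) by ring.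
by rewrite normrM mulrA (le_trans _ h')// mulrC ler_wpM2l// lerDl.
Qed.

Hypothesis Pflat : forall x, 0 <= x <= 1 -> root f^`() (g P.[x]) ->
  exists q, P - P.[x]%:P = q * ('X - x%:P) ^+ (N.*2).+1.

(** A lift is only N^-1-Hoelder, so order [2 * N] of flatness of [P] is spent to get a square. The
    extra unit makes the order odd, as the reparametrization requires; it is given away here through
    [|y - x| <= 1]. *)
Lemma flat_quotient x : 0 <= x <= 1 -> root f^`() (g P.[x]) ->
  exists2 C, 0 <= C & forall y, 0 <= y <= 1 ->
    normc (g P.[y] - g P.[x]) <= C * (y - x) ^+ 2.
Proof.
move=> x01 /(Pflat x01)[q qE]; have [B B0 hB] := real_poly_bounded q.
have N0 : (0 < N)%N by case: (size f) f1 => [|[]].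
set w := normc f.[g 1]; pose K := 1 + w * B.
have wB0 : 0 <= w * B by rewrite mulr_ge0// normc_ge0.
have K1 : 1 <= K by rewrite lerDl.
exists (N%:R * (2 * K)) => [|y y01].
  by rewrite !mulr_ge0// (le_trans ler01).
rewrite -!mulrA; apply: lg.2; [exact: PI|exact: PI| |].
  by rewrite mulr_ge0 ?sqr_ge0// (le_trans ler01).
have -> : P.[y] - P.[x] = q.[y] * (y - x) ^+ (N.*2).+1.
  by have := congr1 (horner^~ y) qE; rewrite !hornerE.
have yx1 : `|y - x| <= 1.
  by case/andP: x01 => ? ?; case/andP: y01 => ? ?; rewrite ler_norml; lra.
rewrite normrM -/w mulrA exprMn -exprM mul2n normrX exprSr mulrA.
have yxE : `|y - x| ^+ N.*2 = (y - x) ^+ N.*2.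
  by rewrite -normrX ger0_norm// -mul2n exprM exprn_ge0// sqr_ge0.
rewrite yxE (@le_trans _ _ (w * B * (y - x) ^+ N.*2))//.
  rewrite (@le_trans _ _ (w * `|q.[y]| * (y - x) ^+ N.*2))//.
    by rewrite ler_piMr// mulr_ge0// ?mulr_ge0 ?normc_ge0// -yxE exprn_ge0.
  by rewrite ler_wpM2r -?yxE ?exprn_ge0// ler_wpM2l ?normc_ge0// hB.
rewrite ler_wpM2r -?yxE ?exprn_ge0//.
by rewrite (@le_trans _ _ K) ?lerDr// ler_eXnr.
Qed.

(** At a critical point flatness gives derivative 0. Elsewhere [f] along [gam] is a polynomial in
    the parameter up to the factor [w]; its difference quotient [G], divided by that of [f], has a
    limit because the derivative of [f] does not vanish. *)
Lemma piece_differentiable : differentiable_on_itv l h gam.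
Proof.
move=> t; rewrite in_itv/= => tI; have x01 := kmI tI.
set x := k * t + m in x01.
have dx u : k * u + m - x = k * (u - t) by rewrite /x; ring.
have [cr|ncr] := boolP (root f^`() (g P.[x])).
  exists 0; have [C C0 hC] := flat_quotient x01 cr.
  apply: cvg_within_dnbhs => e e0.
  have K0 : 0 < C * k ^+ 2 + 1 by rewrite ltr_wpDl// mulr_ge0// sqr_ge0.
  exists (e / (C * k ^+ 2 + 1)); first by rewrite divr_gt0.
  move=> u uI ut; rewrite ler_pdivlMr// subr0 => hu.
  rewrite normcM normcV normcR !gamE//.
  have ut0 : 0 < `|u - t| by rewrite normr_gt0 subr_eq0.
  rewrite ler_pdivrMr// (le_trans (hC _ (kmI uI)))// dx exprMn mulrA.
  rewrite -(real_normK (num_real (u - t))) expr2 mulrA ler_wpM2r//.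
  by rewrite (le_trans _ hu)// mulrC ler_wpM2l// lerDl.
set z := g P.[x] in ncr; have [q qE qz] := poly_factor f z.
have /factor_theorem[p pE] : root (P - P.[x]%:P) x.
  by rewrite /root !hornerE subrr.
set w := f.[g 1]; pose G u : R[i] := (p.[k * u + m] * k)%:C * w.
have gt : gam t = z by rewrite gamE.
have key u : l <= u <= h -> q.[gam u] * (gam u - gam t) = G u * (u - t)%:C.
  move=> uI; have := congr1 (horner^~ (gam u)) qE; rewrite !hornerE gt => <-.
  have [lg1 _] := lg; rewrite /z gamE// (lg1 _ (PI (kmI uI))).
  rewrite (lg1 _ (PI x01)) -/w -mulrBl -rmorphB.
  have := congr1 (horner^~ (k * u + m)) pE; rewrite !hornerE => ->.
  by rewrite dx /G mulrAC -rmorphM !mulrA.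
have cG : (G : R -> R[i]^o) @ within `[l, h] t^' --> (G t : R[i]^o).
  apply: cvg_within_dnbhs => e e0; have [L L0 hL] := real_poly_lip p.
  have K0 : 0 < L * `|k| * `|k| * normc w + 1.
    by rewrite ltr_wpDl// !mulr_ge0// normc_ge0.
  exists (e / (L * `|k| * `|k| * normc w + 1)); first by rewrite divr_gt0.
  move=> u uI ut; rewrite ler_pdivlMr// => hu.
  rewrite /G -mulrBl -rmorphB -mulrBl normcM normcR normrM.
  apply: le_trans hu; rewrite mulrDr mulr1 ler_wpDr//.
  have := hL _ _ (kmI uI) x01; rewrite dx normrM => h'.
  rewrite (_ : `|u - t| * _ = L * (`|k| * `|u - t|) * `|k| * normc w).
    by rewrite !ler_wpM2r// normc_ge0.
  by ring.
have cq : (fun u => q.[gam u] : R[i]^o) @ within `[l, h] t^' --> (f^`().[z] : R[i]^o).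
  apply: cvg_within_dnbhs => e e0; have [d d0 hd] := poly_cts q z e0.
  have [d' d'0 hd'] := piece_cts d0; exists d' => // u uI _ ut.
  by rewrite -qz; apply: hd; rewrite -gt; exact: hd'.
exists (G t / f^`().[z]).
have z0 : f^`().[z] != 0 by [].
have H := cvgM cG (cvgV z0 cq).
suff E : within `[l, h] t^'
    (fun u => G u / q.[gam u] = (gam u - gam t) / (u - t)%:C).
  by move=> A /H HA; apply: filterS2 E HA => u /= <-.
apply: within_dnbhs_near.
have n0 : 0 < normc f^`().[z] / 2 by rewrite divr_gt0// normc_gt0.
have [d d0 hd] := poly_cts q z n0.
have [d' d'0 hd'] := piece_cts d0; exists d' => // u uI ut0 ut.
have qu0 : q.[gam u] != 0.
  rewrite -normc_gt0; have := hd (gam u); rewrite -gt hd'// gt => /(_ isT).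
  have := normc_triangle q.[gam u] f^`().[z] 0; rewrite !subr0.
  by rewrite -qz (normcBC q.[z] q.[gam u]); move: n0; rewrite -qz; lra.
have ut' : (u - t)%:C != 0 by rewrite eq_complex /= eqxx andbT subr_eq0.
by apply/eqP; rewrite eqr_div// -key// mulrC.
Qed.

End OnePiece.

End Reparametrization.

Section DescentPath.
Variables (R : realType) (f : {poly R[i]}) (c : R[i]) (r : R).
Hypotheses (fm : f \is monic) (f1 : (1 < size f)%N).
Hypothesis disk : forall z, root f z -> normc (z - c) <= r.
Local Notation N := (size f).-1.
Implicit Types (s t x y : R) (u v z : R[i]).

Section TwoLifts.
Variables (b : R[i]) (g1 g2 : R -> R[i]).
Hypotheses (cb : root f^`() b) (nb : ~~ root f b).
Hypotheses (lg1 : is_lift f g1) (lg2 : is_lift f g2).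
Hypotheses (g1b : g1 1 = b) (g2b : g2 1 = b).
Hypothesis disj : forall s, 0 <= s < 1 -> g1 s != g2 s.
Local Notation w := f.[b].

(** A lift of [b] can meet a critical point [z] only at the parameter [normc f.[z] / normc w]. These
    finitely many levels are flattened by one [P] that serves all lifts of [b]. *)
Lemma critical_reparam : exists P : {poly R}, [/\ P.[0] = 0, P.[1] = 1,
  forall x y, 0 <= x -> x < y -> y <= 1 -> P.[x] < P.[y] &
  forall g x, is_lift f g -> g 1 = b -> 0 <= x <= 1 -> root f^`() (g P.[x]) ->
    exists q, P - P.[x]%:P = q * ('X - x%:P) ^+ (N.*2).+1].
Proof.
have [rs f'E] := closed_field_poly_normal f^`().
have f'0 : lead_coef f^`() != 0 by rewrite lead_coef_eq0 deriv_monic_neq0.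
have oN : odd (N.*2).+1 by rewrite /= odd_double.
have [P [P0 P1 Pinc Pflat]] :=
  flat_reparam [seq normc f.[z] / normc w | z <- rs] oN.
exists P; split=> // g x [lg _] gb x01 cr; apply: Pflat => //.
have w0 : normc w != 0 by rewrite normc0P.
have Px : 0 <= P.[x] <= 1.
  case/andP: x01 => x0 x1; apply/andP; split.
    by move: x0; rewrite le_eqVlt => /predU1P[<-|x0]; rewrite ?P0// -P0 ltW// Pinc.
  by move: x1; rewrite le_eqVlt => /predU1P[->|x1']; rewrite ?P1// -P1 ltW// Pinc.
apply/mapP; exists (g P.[x]); first by rewrite -root_prod_XsubC -(rootZ _ _ f'0) -f'E.
rewrite lg// gb normcM normcR mulfK// ger0_norm//.
by case/andP: Px.
Qed.

(** Injectivity of the curve turns the bound on the points of a line into a bound on parameters, so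
    the projection on a non-exceptional [v] has variation at most [N] times [2 * normc v * r]. *)
Lemma descent_path : exists gam : R -> R[i],
  [/\ is_path 0 1 gam,
      (path_length 0 1 gam <= (2 * pi * r * N%:R)%:E)%E,
      (forall t, t \in `[0, 1] -> forall u k,
        (forall z, root f z -> dot u z <= k) -> dot u (gam t) <= k),
      [/\ gam 0 = g1 0, gam 1 = g2 0 & gam (1 / 2) = b] &
      is_maximum [set normc f.[gam t] | t in `[0, 1]] (normc w)].
Proof.
have [P [P0 P1 Pinc Pflat]] := critical_reparam.
have PI x : 0 <= x <= 1 -> 0 <= P.[x] <= 1.
  case/andP => x0 x1; apply/andP; split.
    by move: x0; rewrite le_eqVlt => /predU1P[<-|x0]; rewrite ?P0// -P0 ltW// Pinc.
  by move: x1; rewrite le_eqVlt => /predU1P[->|x1']; rewrite ?P1// -P1 ltW// Pinc.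
have Pinj x y : 0 <= x <= 1 -> 0 <= y <= 1 -> P.[x] = P.[y] -> x = y.
  move=> /andP[x0 x1] /andP[y0 y1] xy; apply/eqP; rewrite eq_le !leNgt.
  by apply/andP; split; apply/negP => h; [have := Pinc _ _ y0 h x1|have := Pinc _ _ x0 h y1];
    rewrite xy ltxx.
have w0 : w != 0 by [].
have nw0 : 0 < normc w by rewrite normc_gt0.
(* Both affine maps send 1/2 to 1, that is to [b]; [+ 0] gives the first one the form [k * t + m]
   used for the pieces. *)
pose gam t := if t <= 1 / 2 then g1 P.[2 * t + 0] else g2 P.[- 2 * t + 2].
have gam1 t : 0 <= t <= 1 / 2 -> gam t = g1 P.[2 * t + 0].
  by move=> /andP[_ h]; rewrite /gam h.
have gam2 t : 1 / 2 <= t <= 1 -> gam t = g2 P.[- 2 * t + 2].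
  move=> /andP[h _]; rewrite /gam; case: leP => // h'.
  have -> : t = 1 / 2 by apply/eqP; rewrite eq_le h' h.
  have -> : 2 * (1 / 2) + 0 = 1 :> R by field.
  have -> : - 2 * (1 / 2) + 2 = 1 :> R by field.
  by rewrite P1 g1b g2b.
have I1 t : 0 <= t <= 1 / 2 -> 0 <= 2 * t + 0 <= 1.
  by move=> /andP[? ?]; apply/andP; split; lra.
have I2 t : 1 / 2 <= t <= 1 -> 0 <= - 2 * t + 2 <= 1.
  by move=> /andP[? ?]; apply/andP; split; lra.
have halves t : 0 <= t <= 1 -> 0 <= t <= 1 / 2 \/ 1 / 2 <= t <= 1.
  by move=> /andP[t0 t1]; case: (leP t (1 / 2)) => h; [left; rewrite t0|right; rewrite ltW].
have gamcases t : 0 <= t <= 1 -> exists g s,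
    [/\ gam t = g s, 0 <= s <= 1, is_lift f g & g 1 = b].
  move=> /halves[] h.
    by exists g1, P.[2 * t + 0]; rewrite gam1// PI ?I1.
  by exists g2, P.[- 2 * t + 2]; rewrite gam2// PI ?I2.
have fgam t : 0 <= t <= 1 -> exists2 s, 0 <= s <= 1 & f.[gam t] = s%:C * w.
  by move=> /gamcases[g [s [-> s01 [lg _] gb]]]; exists s; rewrite // lg// gb.
(* The value of [f] determines the parameter on every lift of [b]; a point common to both lifts thus
   has the same parameter on each, and [disj] applies. *)
have level g g' s s' : is_lift f g -> is_lift f g' -> g 1 = b -> g' 1 = b ->
    0 <= s <= 1 -> 0 <= s' <= 1 -> g s = g' s' -> s = s'.
  move=> [lg _] [lg' _] gb g'b s01 s'01 /(congr1 (horner f)).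
  by rewrite lg// lg'// gb g'b => /(mulIf w0)[].
have inj12 s t : 0 <= s <= 1 / 2 -> 1 / 2 <= t <= 1 -> gam s = gam t -> s = t.
  move=> sI tI; rewrite gam1// gam2// => E.
  have E' := level _ _ _ _ lg1 lg2 g1b g2b (PI _ (I1 _ sI)) (PI _ (I2 _ tI)) E.
  have [h|h] := ltP P.[2 * s + 0] 1.
    have /andP[h0 _] := PI _ (I1 _ sI).
    by have := disj (s := P.[2 * s + 0]); rewrite h0 h E -E' eqxx => /(_ isT).
  have e1 : P.[2 * s + 0] = P.[1].
    by apply/eqP; rewrite P1 eq_le h; case/andP: (PI _ (I1 _ sI)) => _ ->.
  have i1 : 0 <= (1 : R) <= 1 by rewrite ler01 lexx.
  have := Pinj _ _ (I1 _ sI) i1 e1.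
  by move: e1; rewrite E' => /(Pinj _ _ (I2 _ tI) i1) h1 h2; lra.
have gaminj s t : 0 <= s <= 1 -> 0 <= t <= 1 -> gam s = gam t -> s = t.
  move=> /halves[] sI /halves[] tI E.
  - move: E; rewrite !gam1// => E.
    have /Pinj h := level _ _ _ _ lg1 lg1 g1b g1b (PI _ (I1 _ sI)) (PI _ (I1 _ tI)) E.
    by have := h (I1 _ sI) (I1 _ tI); lra.
  - exact: inj12.
  - by apply/esym/inj12.
  - move: E; rewrite !gam2// => E.
    have /Pinj h := level _ _ _ _ lg2 lg2 g2b g2b (PI _ (I2 _ sI)) (PI _ (I2 _ tI)) E.
    by have := h (I2 _ sI) (I2 _ tI); lra.
have gamc e : 0 < e -> exists2 d, 0 < d & forall s t, 0 <= s <= 1 ->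
    0 <= t <= 1 -> `|s - t| <= d -> normc (gam s - gam t) <= e.
  move=> e0; have e2 : 0 < e / 2 by rewrite divr_gt0.
  have [d1 d10 h1] := piece_cts f1 lg1 PI I1 gam1 e2.
  have [d2 d20 h2] := piece_cts f1 lg2 PI I2 gam2 e2.
  have i1 : 0 <= (1 / 2 : R) <= 1 / 2 by apply/andP; split; lra.
  have i2 : 1 / 2 <= (1 / 2 : R) <= 1 by apply/andP; split; lra.
  have mix s t : 0 <= s <= 1 / 2 -> 1 / 2 <= t <= 1 ->
      `|s - t| <= Num.min d1 d2 -> normc (gam s - gam t) <= e.
    move=> sI tI; rewrite le_min => /andP[].
    case/andP: (sI) => s0 s1; case/andP: (tI) => t0 t1.
    rewrite distrC ger0_norm => [h3 h4|]; last lra.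
    have := normc_triangle (gam (1 / 2)) (gam s) (gam t).
    have := h1 s (1 / 2) sI i1; rewrite distrC ger0_norm ?subr_ge0// => h5.
    have := h2 (1 / 2) t i2 tI; rewrite distrC ger0_norm ?subr_ge0// => h6.
    have : normc (gam s - gam (1 / 2)) <= e / 2 by apply: h5; lra.
    have : normc (gam (1 / 2) - gam t) <= e / 2 by apply: h6; lra.
    lra.
  exists (Num.min d1 d2) => [|s t]; first by rewrite lt_min d10.
  have ee : e / 2 <= e by lra.
  move=> /halves[] sI /halves[] tI h.
  - apply: (le_trans _ ee); apply: h1 => //.
    by rewrite (le_trans h)// ge_min lexx.
  - exact: mix.
  - by rewrite normcBC; apply: mix => //; rewrite distrC.
  - apply: (le_trans _ ee); apply: h2 => //.
    by rewrite (le_trans h)// ge_min lexx orbT.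
have gamhull t : 0 <= t <= 1 -> forall u k,
    (forall z, root f z -> dot u z <= k) -> dot u (gam t) <= k.
  move=> /gamcases[g [s [-> s01 lg gb]]] u k hk.
  by apply: (lift_halfplane fm f1 lg _ hk s01); rewrite gb.
have r0 : 0 <= r.
  have /closed_rootP[z /disk] : size f != 1%N by case: (size f) f1 => [|[]].
  exact: le_trans (normc_ge0 _).
have range v t : 0 <= t <= 1 ->
    dot v c - normc v * r <= dot v (gam t) <= dot v c + normc v * r.
  move=> t01.
  have bound u z : root f z -> dot u z <= dot u c + normc u * r.
    move=> rz; rewrite -lerBlDl -dotB (le_trans (ler_norm _))//.
    by rewrite (le_trans (dot_le _ _))// ler_wpM2l ?normc_ge0 ?disk.
  rewrite (gamhull t t01 v _ (bound v)) andbT.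
  have := gamhull t t01 (- v) _ (bound (- v)).
  have dotNl z : dot (- v) z = - dot v z.
    by rewrite /dot; case: (v) => a d /=; ring.
  by rewrite !dotNl normcNE; lra.
have var v (s : seq R) : im (('i * v) ^+ N * w^*%C) != 0 ->
    itv_partition 0 1 s ->
    \sum_(0 <= i < size s) `|dot v (gam (nth 1 s i) - gam (nth 1 (0 :: s) i))|
      <= N%:R * (2 * (normc v * r)).
  move=> hv Ps; have vr : 0 <= normc v * r by rewrite mulr_ge0 ?normc_ge0.
  have -> : 2 * (normc v * r) = dot v c + normc v * r - (dot v c - normc v * r).
    by ring.
  under eq_bigr do rewrite dotB.
  apply: (@variation_bound _ N (fun t => dot v (gam t))) => //.
  - apply: within_continuous_eps => x e /=; rewrite in_itv/= => x01 e0.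
    have v0 : 0 < normc v + 1 by rewrite ltr_wpDl// normc_ge0.
    have [d d0 hd] := gamc _ (divr_gt0 e0 v0); exists d => // y.
    rewrite in_itv/= => y01 yx; rewrite -dotB (le_trans (dot_le _ _))//.
    have := hd y x y01 x01 yx; rewrite ler_pdivlMr// => h.
    by rewrite (le_trans _ h)// mulrC ler_wpM2l ?normc_ge0// lerDl.
  - by lra.
  - by move=> t t01; exact: range.
  - move=> y ts uts hts; rewrite -(size_map gam).
    apply: (@line_count _ f v w y) => //.
      rewrite map_inj_in_uniq// => t t' /hts[t01 _] /hts[t'01 _]; exact: gaminj.
    move=> _ /mapP[t /hts[t01 ty] ->]; split=> //.
    have [k _ ->] := fgam t t01; rewrite -mulrA.
    by case: (w) => a d /=; ring.
have i1 : 0 <= (1 : R) <= 1 by rewrite ler01 lexx.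
have i0 : 0 <= (0 : R) <= 1 by rewrite ler01 lexx.
have h0 : gam 0 = g1 0.
  by rewrite gam1 ?mulr0 ?addr0 ?P0//; apply/andP; split; lra.
have h1 : gam 1 = g2 0.
  by rewrite gam2 ?mulr1 ?addNr ?P0//; apply/andP; split; lra.
have h12 : gam (1 / 2) = b.
  rewrite gam1; last by apply/andP; split; lra.
  by have -> : 2 * (1 / 2) + 0 = 1 :> R by [field]; rewrite P1.
exists gam; split => //.
- split; first exact: within_continuous_epsc.
  exists [:: 1 / 2; 1]; first by split=> //=; rewrite !andbT; apply/andP; split; lra.
  move=> [|[|//]] _ /=.
    apply: (piece_differentiable f1 lg1 PI I1 gam1) => x x01; exact: Pflat.
  apply: (piece_differentiable f1 lg2 PI I2 gam2) => x x01; exact: Pflat.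
- apply: ge_ereal_sup => _ [s Ps <-]; rewrite lee_fin.
  have N0 : (0 < N)%N by case: (size f) f1 => [|[]].
  have [u [u0 hu hiu]] := exists_direction N0 w0.
  have nu0 : 0 < normc u by rewrite normc_gt0.
  have niu : normc ('i * u) = normc u.
    by rewrite normcM /normc /= expr0n add0r expr1n sqrtr1 mul1r.
  rewrite -(ler_pM2l nu0) mulr_sumr.
  have := lerD (var u s hu Ps) (var ('i * u) s hiu Ps); rewrite niu -big_split/=.
  have le1 : \sum_(0 <= i < size s)
       normc u * normc (gam (nth 1 s i) - gam (nth 1 (0 :: s) i)) <=
     \sum_(0 <= i < size s)
       (`|dot u (gam (nth 1 s i) - gam (nth 1 (0 :: s) i))| +
        `|dot ('i * u) (gam (nth 1 s i) - gam (nth 1 (0 :: s) i))|).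
    by apply: ler_sum => i _; exact: normc_le_dot.
  move=> /(le_trans le1) le2; apply: (le_trans le2).
  have -> : N%:R * (2 * (normc u * r)) + N%:R * (2 * (normc u * r)) =
    normc u * (2 * 2 * r * N%:R) by ring.
  rewrite ler_wpM2l ?(ltW nu0)// !ler_wpM2r//.
  by rewrite ler_wpM2l// pi_ge2.
- split.
    by exists (1 / 2); rewrite /= ?h12// in_itv/=; apply/andP; split; lra.
  move=> _ [t /= + <-]; rewrite in_itv/= => /fgam[s /andP[s0 s1] ->].
  by rewrite normcM normcR ger0_norm// ler_piMl// normc_ge0.
Qed.

End TwoLifts.
End DescentPath.

(** * Connectivity *)

Lemma maximal_seq (T : eqType) (P : T -> Prop) n :
  (forall xs : seq T, uniq xs -> (forall x, x \in xs -> P x) -> (size xs <= n)%N) ->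
  exists xs : seq T, [/\ uniq xs, forall x, x \in xs -> P x &
    forall x, P x -> x \in xs].
Proof.
move=> hn.
pose Q k := `[< exists xs : seq T, [/\ uniq xs, size xs = k &
  forall x, x \in xs -> P x] >].
have exQ : exists k, Q k by exists 0%N; apply/asboolP; exists [::].
have ubQ k : Q k -> (k <= n)%N.
  by move=> /asboolP[xs [uxs <- xsP]]; exact: hn.
case: (ex_maxnP exQ ubQ) => k /asboolP[xs [uxs sxs xsP]] kmax.
exists xs; split=> // x Px; apply/negPn/negP => xxs.
suff /kmax : Q k.+1 by rewrite ltnn.
apply/asboolP; exists (x :: xs); split; rewrite /= ?xxs ?sxs// => y.
by rewrite inE => /predU1P[->//|]; exact: xsP.
Qed.

Section Connectivity.
Variables (R : realType) (f : {poly R[i]}).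
Hypotheses (fm : f \is monic) (f1 : (1 < size f)%N).
Implicit Types (s t e : R) (a b x z : R[i]) (g h : R -> R[i]).

Definition lift_from z g := is_lift f g /\ g 1 = z.

Lemma lift_from_tail z g s : lift_from z g -> 0 <= s <= 1 ->
  lift_from (g s) (fun t => g (s * t)).
Proof. by move=> [lg _] s01; split; [exact: lift_tail|rewrite mulr1]. Qed.

Lemma lift_fromE z g s : lift_from z g -> 0 <= s <= 1 ->
  f.[g s] = s%:C * f.[z].
Proof. by move=> [[lg _] <-] s01; exact: lg. Qed.

(** When [f] vanishes at [z], the radius [d = 0] is admissible and the lift is constant. *)
Lemma lift_from_root z g s : lift_from z g -> root f z -> 0 <= s <= 1 -> g s = z.
Proof.
move=> [[_ lg] gz] /eqP fz s01; rewrite -gz; apply/eqP.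
rewrite -subr_eq0 -normc0P eq_le normc_ge0 andbT.
have i1 : 0 <= (1 : R) <= 1 by rewrite ler01 lexx.
have := lg s 1 0 s01 i1 (lexx 0); rewrite gz fz normc0 mul0r exprn_ge0//.
by rewrite !mulr0 => /(_ isT).
Qed.

Definition meet_below g h := exists2 s, 0 <= s < 1 & g s = h s.

(** These are the edges for which a path can be drawn: the two lifts must meet at [b] only. *)
Definition admissible b (p : R[i] * R[i]) := exists g h,
  [/\ lift_from b g, lift_from b h, ~ meet_below g h, g 0 = p.1 & h 0 = p.2].

(** Agreement at [s0] replaces equality of lifts: the values at [s0] are finitely many, while
    several lifts may pass through each, and these are compared by induction from the lower
    point. *)
Definition star b (l : seq (R[i] * R[i])) := exists s0 g0,
  [/\ 0 <= s0 < 1, lift_from b g0 & forall g, lift_from b g ->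
     exists h, [/\ lift_from b h, h s0 = g s0 &
       (g0 0, h 0) \in l \/ meet_below g0 h]].

(** One lift is chosen for each value taken at [s0]; the first is the centre, which leaves at most
    as many others as the multiplicity of [b]. A chosen lift meeting the centre below [b] gets no
    edge. *)
Lemma star_exists b : exists l, [/\ (size l <= mup b f^`())%N, star b l &
  forall p, p \in l -> admissible b p].
Proof.
have [s0 /andP[s00 s01] cnt] := lift_count fm f1 b.
have s0I : s0 <= s0 <= 1 by rewrite lexx ltW.
pose P x := exists g, lift_from b g /\ g s0 = x.
have [xs [uxs xsP Pxs]] : exists xs : seq R[i], [/\ uniq xs,
    forall x, x \in xs -> P x & forall x, P x -> x \in xs].
  apply: (@maximal_seq _ P (mup b f^`()).+1) => xs uxs xsP.
  by apply: (cnt s0) => // x /xsP[g [[lg gb] gx]]; exists g.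
have sxs : (size xs <= (mup b f^`()).+1)%N.
  by apply: (cnt s0) => // x /xsP[g [[lg gb] gx]]; exists g.
have [g0' lg0' g0b'] := lift_exists fm f1 b.
have /choice[lam hlam] x : exists g, x \in xs -> lift_from b g /\ g s0 = x.
  have [/xsP[g hg]|] := boolP (x \in xs); first by exists g.
  by exists g0'.
case: xs uxs xsP Pxs sxs hlam => [|x0 xs] uxs xsP Pxs sxs hlam.
  by have /Pxs : P (g0' s0) by exists g0'.
have [lg0 _] := hlam x0 (mem_head _ _).
pose l := [seq (lam x0 0, lam x 0) | x <- xs & `[< ~ meet_below (lam x0) (lam x) >]].
exists l; split.
- by rewrite size_map size_filter (leq_trans (count_size _ _)).
- exists s0, (lam x0); split=> //; first by rewrite s00.
  move=> g lg; have gxs : g s0 \in x0 :: xs by apply: Pxs; exists g.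
  have [lh hs] := hlam _ gxs; exists (lam (g s0)); split=> //.
  have [mt|nmt] := pselect (meet_below (lam x0) (lam (g s0))); first by right.
  move: gxs; rewrite inE => /predU1P[gx|gxs].
    by right; rewrite gx; exists 0; rewrite ?lexx ?ltr01.
  by left; apply/mapP; exists (g s0) => //; rewrite mem_filter gxs andbT; apply/asboolP.
- move=> p /mapP[x]; rewrite mem_filter => /andP[/asboolP nm xxs] ->.
  have [lx _] := hlam x (mem_behead (s := x0 :: xs) xxs).
  by exists (lam x0), (lam x).
Qed.

Variables (B : {fset R[i]}) (L : R[i] -> seq (R[i] * R[i])).
Hypothesis B_roots : forall z, (z \in B) = root f^`() z && ~~ root f z.
Hypothesis L_star : forall b, b \in B -> star b (L b).
Local Notation linked := (conn (fun u v => has (fun b => adj (L b) u v) B)).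

Let link_sym : symmetric (fun u v => has (fun b => adj (L b) u v) B).
Proof. by move=> u v; apply: eq_has => b; exact: adj_sym. Qed.

(* Two lifts of [z] first part at a critical point [b]. Below [b] they are
   compared with lifts in the star of [b], inductively on [|f|]. *)
Lemma lifts_linked z g h : lift_from z g -> lift_from z h ->
  linked (g 0) (h 0).
Proof.
(* The induction measure: the number of points of [B] that are not higher than [z]. *)
pose cr z := count (fun b => normc f.[b] <= normc f.[z]) (enum_fset B).
move: {2}(cr z) (leqnn (cr z)) => n; elim/ltn_ind: n z g h => n IH z g h zn lg lh.
have i1 : 0 <= (1 : R) <= 1 by rewrite ler01 lexx.
have i0 : 0 <= (0 : R) <= 1 by rewrite ler01 lexx.
have [fz|fz] := boolP (root f z).
  by rewrite (lift_from_root lg fz i0) (lift_from_root lh fz i0); exact: conn_refl.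
(* Going down from [z], the lifts part at the infimum of [T]. *)
pose T := [set s | 0 <= s <= 1 /\ forall t, s <= t <= 1 -> g t = h t].
have T1 : T 1.
  split=> // t /andP[t1 t1']; have -> : t = 1 by apply/eqP; rewrite eq_le t1 t1'.
  by rewrite lg.2 lh.2.
have infT : has_inf T.
  by split; [exists 1|exists 0 => s [/andP[]]].
set s := inf T.
have s0 : 0 <= s by apply: lb_le_inf; [exists 1|move=> t [/andP[]]].
have s1 : s <= 1 by apply: ge_inf; [case: infT|].
have sI : 0 <= s <= 1 by rewrite s0.
have above t : s < t -> t <= 1 -> g t = h t.
  move=> st t1; have ts0 : 0 < t - s by rewrite subr_gt0.
  have [u [_ hu]] := inf_adherent ts0 infT; rewrite -/s addrC subrK => ut.
  by apply: hu; rewrite (ltW ut).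
have gs : g s = h s.
  have [s1'|s1'] := ltP s 1; last first.
    have -> : s = 1 by apply/eqP; rewrite eq_le s1 s1'.
    by rewrite lg.2 lh.2.
  apply/eqP; rewrite -subr_eq0; apply/eqP/normc_le_eq0 => e e0.
  have e2 : 0 < e / 2 by rewrite divr_gt0.
  have [d1 d10 h1] := lift_cts f1 lg.1 e2.
  have [d2 d20 h2] := lift_cts f1 lh.1 e2.
  pose d := Num.min d1 d2; have d0 : 0 < d by rewrite lt_min d10.
  pose t := Num.min 1 (s + d).
  have st : s < t by rewrite lt_min s1' ltrDl.
  have t1 : t <= 1 by rewrite ge_min lexx.
  have tI : 0 <= t <= 1 by rewrite t1 andbT (le_trans s0)// ltW.
  have : `|s - t| <= d.
    by rewrite distrC gtr0_norm ?subr_gt0// lerBlDl ge_min lexx orbT.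
  rewrite le_min => /andP[/(h1 _ _ sI tI) + /(h2 _ _ sI tI)].
  have := normc_triangle (g t) (g s) (h s).
  by rewrite (above t st t1) (normcBC (h t)); lra.
have [s00|sn0] := eqVneq s 0; first by rewrite -s00 gs; exact: conn_refl.
have sp : 0 < s by rewrite lt_def sn0.
set x := g s in gs.
have lg' := lift_from_tail lg sI; have lh' := lift_from_tail lh sI.
rewrite -gs in lh'; rewrite -/x in lg'.
have fx : f.[x] = s%:C * f.[z] by exact: lift_fromE.
have fxz : normc f.[x] <= normc f.[z].
  by rewrite fx normcM normcR ger0_norm// ler_piMl// normc_ge0.
have fx0 : ~~ root f x.
  rewrite /root fx mulf_eq0 negb_or fz andbT.
  by rewrite eq_complex /= eqxx andbT.
have [xB|xB] := boolP (x \in B); last first.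
  have ncr : ~~ root f^`() x by move: xB; rewrite B_roots fx0 andbT.
  have [u /andP[u0 u1] cnt] := lift_count fm f1 x.
  (* With multiplicity 0, all lifts of [x] agree just below it, against the choice of [s] as an
     infimum. *)
  rewrite (mupNroot ncr) in cnt.
  suff : T (s * u).
    move=> /(ge_inf infT.2); rewrite -/s -[leLHS]mulr1 ler_pM2l//.
    by rewrite leNgt u1.
  split; first by rewrite mulr_ge0// mulr_ile1// ltW.
  move=> t /andP[sut t1]; have [st|st] := ltP s t; first exact: above.
  have -> : t = s * (t / s) by rewrite mulrC divfK.
  set v := t / s; apply/eqP/negPn/negP => gh.
  have vI : u <= v <= 1 by rewrite ler_pdivlMr// mulrC sut ler_pdivrMr// mul1r.
  have := cnt v [:: g (s * v); h (s * v)] vI; rewrite /= inE gh /= => /(_ isT).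
  suff H : forall y, y \in [:: g (s * v); h (s * v)] ->
      exists g', [/\ is_lift f g', g' 1 = x & g' v = y] by move=> /(_ H).
  move=> y; rewrite !inE => /orP[]/eqP->.
    by exists (fun t => g (s * t)); case: lg' => ? ?; split.
  by exists (fun t => h (s * t)); case: lh' => ? ?; split.
(* The meeting point is strictly lower than [x], so [cr] no longer counts [x] there and the
   induction applies to the two tails. *)
have below g' h' : lift_from x g' -> lift_from x h' -> meet_below g' h' ->
    linked (g' 0) (h' 0).
  move=> lg1 lh1 [u /andP[u0 u1] gu].
  have uI : 0 <= u <= 1 by rewrite u0 ltW.
  have l1 := lift_from_tail lg1 uI; have l2 := lift_from_tail lh1 uI.
  rewrite -gu in l2.
  have fy : normc f.[g' u] < normc f.[x].
    rewrite (lift_fromE lg1 uI) normcM normcR ger0_norm//.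
    by rewrite gtr_pMl// normc_gt0.
  have lt_cr : (cr (g' u) < n)%N.
    apply: leq_trans zn; rewrite /cr -!size_filter.
    apply: (@leq_trans (size (x :: [seq b <- enum_fset B | normc f.[b] <= normc f.[g' u]])))=> //.
    apply: uniq_leq_size => [|y] /=.
      rewrite filter_uniq ?fset_uniq// andbT mem_filter negb_and -ltNge fy//.
    rewrite inE !mem_filter => /predU1P[->|/andP[yu yB]].
      by rewrite fxz.
    by rewrite yB andbT (le_trans yu)// (le_trans (ltW fy)).
  by have := IH _ lt_cr _ _ _ (leqnn _) l1 l2; rewrite !mulr0.
have [u [g0 [/andP[u0 u1] lg0 hst]]] := L_star xB.
(* The centre is reached in two moves: to a lift agreeing at [u], then by an edge at [x] or a
   meeting below. *)
have to_g0 g' : lift_from x g' -> linked (g' 0) (g0 0).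
  move=> lg1; have [h' [lh1 hu alt]] := hst _ lg1.
  apply: (@conn_trans _ _ (h' 0)).
    by apply: below => //; exists u; rewrite ?u0 ?hu.
  apply: (conn_sym link_sym); case: alt => [mem|]; last exact: below.
  by apply: conn1; apply/hasP; exists x => //; rewrite /adj mem.
have := conn_trans (to_g0 _ lg') (conn_sym link_sym (to_g0 _ lh')).
by rewrite !mulr0.
Qed.

Variable A : {fset R[i]}.
Hypothesis A_roots : forall z, (z \in A) = root f z.

Lemma lift_end_root z g : lift_from z g -> g 0 \in A.
Proof.
move=> lg; rewrite A_roots /root (lift_fromE lg) ?lexx ?ler01//.
by rewrite mul0r.
Qed.

(** Ends lie in the finite set [A], so this is a finite union of sets with a prescribed end, each
    closed by [lift_closed]. *)
Lemma closed_lift_ends z0 z1 (Q : R[i] -> Prop) :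
  closed [set t : R | 0 <= t <= 1 /\
    exists g, lift_from (z0 + t%:C * (z1 - z0)) g /\ Q (g 0)].
Proof.
pose z t := z0 + t%:C * (z1 - z0).
have -> : [set t : R | 0 <= t <= 1 /\ exists g, lift_from (z t) g /\ Q (g 0)] =
    \bigcup_(a in [set a | a \in A /\ Q a])
      [set t : R | 0 <= t <= 1 /\ exists g, lift_from (z t) g /\ g 0 = a].
  apply/seteqP; split=> [t [tI [g [lg Qg]]]|t [a [aA Qa] [tI [g [lg ga]]]]].
    by exists (g 0); [split=> //; exact: lift_end_root lg|split=> //; exists g].
  by split=> //; exists g; rewrite ga.
apply: closed_bigcup.
  by apply: (sub_finite_set _ (finite_fset A)) => a [].
move=> a _ t clt.
have tI : 0 <= t <= 1.
  have : closed (`[0, 1] : set R) by exact: interval_closed.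
  move=> /(_ t); rewrite /= in_itv/=; apply.
  by move=> V /clt[u [[uI _] uV]]; exists u; rewrite /= in_itv.
split=> //.
have [|g [lg gz g0]] := @lift_closed R f f1 (z t) a; last by exists g.
move=> e e0; have K0 : 0 < normc (z1 - z0) + 1 by rewrite ltr_wpDl// normc_ge0.
have d0 : 0 < e / (normc (z1 - z0) + 1) by rewrite divr_gt0.
have [u [[uI [g [[lg gz] g0]]] ut]] := clt _ (nbhsx_ballx t _ d0).
exists g; split=> //; rewrite gz /z.
have -> : z0 + u%:C * (z1 - z0) - (z0 + t%:C * (z1 - z0)) = (u - t)%:C * (z1 - z0).
  by rewrite rmorphB; ring.
move: ut; rewrite /ball /= distrC => /ltW; rewrite ler_pdivlMr// => ut.
rewrite normcM normcR (le_trans _ ut)// ler_wpM2l// lerDl//.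
Qed.

(** On the segment from [a0] to [a1], the points with a lift ending in the component of [a0] and
    those with a lift ending outside form two closed sets, complementary because all lifts of a
    point end in one component. At the roots [a0] and [a1] lifts are constant. *)
Lemma roots_linked a0 a1 : a0 \in A -> a1 \in A -> linked a0 a1.
Proof.
move=> a0A a1A; pose z t := a0 + t%:C * (a1 - a0).
pose K (Q : R[i] -> Prop) := [set t : R | 0 <= t <= 1 /\
  exists g, lift_from (z t) g /\ Q (g 0)].
have i1 : 0 <= (1 : R) <= 1 by rewrite ler01 lexx.
have i0 : 0 <= (0 : R) <= 1 by rewrite ler01 lexx.
have lift1 x : exists g, lift_from x g.
  by have [g lg gx] := lift_exists fm f1 x; exists g.
have : K (linked a0) = `[0, 1]%classic.
  apply: (@segment_connected R 0 1).
  - exists 0; split=> //; have [g lg] := lift1 (z 0); exists g; split=> //.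
    move: (lg); rewrite /z mul0r addr0 => lg'.
    by rewrite (lift_from_root lg') -?A_roots//; exact: conn_refl.
  - exists (~` K (fun a => ~ linked a0 a)).
      exact/closed_openC/closed_lift_ends.
    apply/seteqP; split=> t /=.
      move=> [tI [g [lg lk]]]; rewrite in_itv/=; split=> // -[_ [h [lh]]].
      by apply; apply: (conn_trans lk); exact: lifts_linked lg lh.
    rewrite in_itv/= => -[tI nK]; split=> //; have [g lg] := lift1 (z t).
    exists g; split=> //; apply: contrapT => nl; apply: nK; split=> //.
    by exists g.
  - exists (K (linked a0)); first exact: closed_lift_ends.
    apply/seteqP; split=> t /=; last by case.
    by move=> h; split=> //; case: h => + _; rewrite in_itv.
move=> KE; have : K (linked a0) 1 by rewrite KE /= in_itv.
move=> [_ [g [lg lk]]]; move: lg; rewrite /z mul1r addrC subrK => lg.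
by move: lk; rewrite (lift_from_root lg) -?A_roots.
Qed.

End Connectivity.

Lemma eq_of_leq_sum (T : choiceType) (B : {fset T}) (m n : T -> nat) :
  (forall b, b \in B -> (m b <= n b)%N) ->
  (\sum_(b <- B) m b = \sum_(b <- B) n b)%N -> forall b, b \in B -> m b = n b.
Proof.
have aux (i j k l : nat) : (i + k = j + l -> i <= j -> k <= l -> i = j)%N by lia.
move=> mn e b bB; have bB' : b \in enum_fset B by [].
move: e; rewrite !(big_rem b bB')/= => e; apply: (aux _ _ _ _ e (mn b bB)).
rewrite big_seq [leqRHS]big_seq; apply: leq_sum => x /mem_rem xB.
exact: mn.
Qed.

Theorem theorem6p1 (R : realType) (f : {poly R[i]}) (N : nat)
    (A B : {fset R[i]}) (c : R[i]) (r : R)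
    (f_monic : f \is monic) (f_degree : size f = N.+1)
    (f_nonconstant : (0 < N)%N)
    (A_roots : forall z, (z \in A) = root f z)
    (B_roots : forall z, (z \in B) = root f^`() z && ~~ root f z)
    (A_disk : forall z, z \in A -> Normc.normc (z - c) <= r) :
  exists (G : graph R[i]) (label : edges G -> B),
    [/\ is_tree G,
        vertices G = A,
        #|` edges G| = (#|` A| - 1)%N,
        (forall beta : B,
           #|[pred e | label e == beta]| = mup (val beta) f^`())
      & forall (e : edges G) (alpha alpha' : R[i]),
          val e = [fset alpha; alpha']%fset ->
          exists gamma : R -> R[i],
            [/\ is_path 0 1 gamma,
                (path_length 0 1 gamma <= (2 * pi * r * N%:R)%:E)%E,
                (forall t, t \in `[0, 1] ->
                   convex_hull [set` A] (gamma t)),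
                [/\ gamma 0 = alpha, gamma 1 = alpha'
                  & gamma (1 / 2) = val (label e)]
              & is_maximum [set Normc.normc f.[gamma t] | t in `[0, 1]]
                  (Normc.normc f.[val (label e)])]].
Proof.
have f1 : (1 < size f)%N by rewrite f_degree ltnS.
have sfN : (size f).-1 = N by rewrite f_degree.
have A0 : A != fset0.
  have /closed_rootP[z rz] : size f != 1%N by case: (size f) f1 => [|[]].
  by apply/fset0Pn; exists z; rewrite A_roots.
have /choice[L hL] := star_exists f_monic f1.
have sumB : (\sum_(b <- B) mup b f^`() = #|` A| - 1)%N.
  exact: sum_mup_critical.
have L_le b : (size (L b) <= mup b f^`())%N by case: (hL b).
have L_star b : b \in B -> star f b (L b) by case: (hL b).
have L_adm b p : p \in L b -> admissible f b p by case: (hL b) => _ _; apply.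
have LA b p : b \in B -> p \in L b -> p.1 \in A /\ p.2 \in A.
  move=> _ /L_adm[g [h [lg lh _ <- <-]]].
  by split; [exact: lift_end_root lg|exact: lift_end_root lh].
have cA x y : x \in A -> y \in A ->
    conn (fun u v => has (fun b => adj (L b) u v) B) x y.
  exact: (roots_linked f_monic f1 B_roots L_star A_roots).
have sL : (\sum_(b <- B) size (L b) <= #|` A| - 1)%N.
  by rewrite -sumB; apply: leq_sum.
have [sumL [G [label [treeG vG eG labelG edgeG]]]] := tree_of_lists A0 LA cA sL.
exists G, label; split=> //.
  move=> b; rewrite labelG.
  by apply: (eq_of_leq_sum (fun b _ => L_le b) _ (valP b)); rewrite sumL sumB.
move=> e alpha alpha' eE; set b := val (label e).
have [p pL pE] := edgeG e.
have /andP[cb nb] : root f^`() b && ~~ root f b by rewrite -B_roots (valP (label e)).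
have [g [h [lg lh gh g0 h0]]] : admissible f b (alpha, alpha').
  (* An edge is unordered while the lists hold ordered pairs, so the two lifts may have to be
     exchanged. *)
  have := edge_ofE alpha alpha' p; rewrite -eE pE eqxx => /esym/orP[]/eqP pP.
    by rewrite pP; exact: L_adm.
  have [g [h [lg lh gh g0 h0]]] := L_adm _ _ pL; rewrite -pP in g0 h0.
  exists h, g; split=> // -[s sI hs]; apply: gh; by exists s.
have disj s : 0 <= s < 1 -> g s != h s.
  by move=> sI; apply/eqP => ghs; apply: gh; exists s.
have disk z : root f z -> Normc.normc (z - c) <= r.
  by rewrite -A_roots; exact: A_disk.
have [gam [pgam lgam hgam [gam0 gam1 gam12] mgam]] :=
  descent_path f_monic f1 disk cb nb lg.1 lh.1 lg.2 lh.2 disj.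
exists gam; split=> //.
- by rewrite sfN in lgam.
- move=> t tI; apply: (convex_hull_halfplanes A0) => u k hk.
  by apply: (hgam t tI) => z; rewrite -A_roots; exact: hk.
- by rewrite gam0 gam1 g0 h0.
Qed.
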